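(* Let $k=\mathbb{C}$, let $A=k[\Gamma]$ be a monomial curve, and let $D=\mathrm{Diff}(A)$ be its ring of $k$-linear differential operators. Let $M$ be a non-zero, finitely generated left $D$-module and let $\{M_n\}$ be a good filtration of $M$. Then there is a positive integer $m\ge 1$ and polynomials $P_r(t)\in\mathbb{Q}[t]$ for $0\le r<m$, such that $\dim_k(M_{nm+r})=P_r(n)$ for $0\le r<m$ and all sufficiently large integers $n$. Moreover, $$P_r(t)=\frac{e}{d!}\,t^d+\text{ terms of lower degree}$$ for $0\le r<m$, where $d$ is the Krull dimension of $\mathrm{gr}\,M$, and $e>0$ is a positive integer (the same for all $r$).
   Context: Let $k=\mathbb{C}$ and $\mathbb{N}_0=\{0,1,2,\dots\}$. A numerical semigroup is a submonoid $\Gamma\subseteq\mathbb{N}_0$ with $\mathbb{N}_0\setminus\Gamma$ finite; its semigroup algebra $A=k[\Gamma]=\bigoplus_{n\in\Gamma}k\,t^n\subseteq k[t]$ is called a monomial curve. Put $T=k[t,t^{-1}]$ and $\partial=d/dt$. The ring $\mathrm{Diff}(T)=k[t,t^{-1}]\langle\partial\rangle$ is graded by letting $t^n\partial^m$ have degree $n-m$. The ring $D=\mathrm{Diff}(A)$ of $k$-linear differential operators on $A$ is identified with the graded subring $\{P\in\mathrm{Diff}(T):P(A)\subseteq A\}$, and we write $D=\bigoplus_w D_w$. Bernstein filtration: let $D^p_w$ be the space of operators in $D_w$ of order at most $p$, and let $B^n=\sum_{2p+w\le n}D^p_w$ for each integer $n$. This is a filtration of $D$ with $B^n=0$ for $n<0$,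 $B^0=k$, and all $B^n$ finite dimensional over $k$. Its associated graded ring is the commutative ring $\mathrm{gr}\,D=\bigoplus_n B^n/B^{n-1}$. A filtration of a left $D$-module $M$ is a chain $M_0\subseteq M_1\subseteq\cdots$ of $k$-linear subspaces of $M$ such that $\bigcup_n M_n=M$ and $B^m\cdot M_n\subseteq M_{m+n}$ for all $m,n\ge 0$, with $M_n=0$ for $n<0$ by convention. It is good if $\mathrm{gr}\,M=\bigoplus_n M_n/M_{n-1}$ is a finitely generated module over $\mathrm{gr}\,D$. The Krull dimension of $\mathrm{gr}\,M$ is its Krull dimension as a module over $\mathrm{gr}\,D$. *)

(* Defs.v *)
From HB Require Import structures.
From mathcomp Require Import all_boot all_order all_algebra.
From mathcomp Require Import boolp classical_sets functions cardinality.
From mathcomp Require Import finmap.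
From mathcomp Require Import reals complex.
From mathcomp.multinomials Require Import monalg.

Set Implicit Arguments.
Unset Strict Implicit.
Unset Printing Implicit Defensive.

Import Order.TTheory GRing.Theory Num.Theory.

Local Open Scope ring_scope.

Section Laurent.
Variable k : numFieldType.

(* k[t, t^-1]; the basis vector << n >> is t^n. *)
Definition laurent := {malg k[int]}.
HB.instance Definition _ := GRing.Lmodule.on laurent.
Implicit Types (f g : laurent) (h : int -> laurent).

(* The k-linear endomorphism t^j |-> h j. *)
Definition linext h f : laurent := \sum_(j <- msupp f) f@_j *: h j.

Definition lmul f g : laurent :=
  linext (fun i => linext (fun j => << i + j >>) g) f.

Definition lder : laurent -> laurent := linext (fun j => j%:~R *: << j - 1 >>).

Lemma linextwE h f (d : {fset int}) : {subset msupp f <= d} ->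
  linext h f = \sum_(j <- d) f@_j *: h j.
Proof.
move=> sfd; rewrite /linext [RHS](bigID (mem (msupp f))) /= [X in _ + X]big1 ?addr0.
  rewrite -[RHS]big_filter; apply: perm_big; apply: uniq_perm.
  - exact: fset_uniq.
  - by rewrite filter_uniq // fset_uniq.
  - move=> j; rewrite mem_filter /=.
    by case: (boolP (j \in msupp f)) => // /sfd ->.
by move=> j jf; rewrite mcoeff_outdom // scale0r.
Qed.

Lemma linext_linear h : linear (linext h).
Proof.
move=> c f g.
have s1 : {subset msupp (c *: f + g) <= (msupp f `|` msupp g)%fset}.
  move=> j; rewrite -mcoeff_neq0 mcoeffD mcoeffZ inE.
  apply: contraR; rewrite negb_or => /andP[jf jg].
  by rewrite !mcoeff_outdom // mulr0 addr0.
have s2 : {subset msupp f <= (msupp f `|` msupp g)%fset}.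
  by move=> j; rewrite inE => ->.
have s3 : {subset msupp g <= (msupp f `|` msupp g)%fset}.
  by move=> j; rewrite inE => ->; rewrite orbT.
rewrite (linextwE _ s1) (linextwE _ s2) (linextwE _ s3) scaler_sumr -big_split.
apply: eq_bigr => j _ /=.
by rewrite mcoeffD mcoeffZ scalerDl scalerA.
Qed.

HB.instance Definition _ h :=
  GRing.isLinear.Build k laurent laurent _ (linext h) (linext_linear h).

Lemma linextU h j : linext h << j >> = h j.
Proof.
rewrite (@linextwE _ _ [fset j]%fset); last first.
  by move=> i; rewrite -mcoeff_neq0 mcoeffU inE; case: (eqVneq j i); rewrite ?eqxx // eq_sym.
by rewrite big_seq_fset1 mcoeffUU scale1r.
Qed.

Lemma laurentE f : f = linext (fun j => << j >>) f.
Proof.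
apply/malgP => j; rewrite /linext raddf_sum /=.
case: (boolP (j \in msupp f)) => jf.
  rewrite (bigD1_seq j) ?fset_uniq //= mcoeffZ mcoeffUU mulr1 big1 ?addr0 //.
  by move=> i ij; rewrite mcoeffZ mcoeffU (negPf ij) mulr0.
rewrite mcoeff_outdom // big_seq big1 // => i iF; rewrite mcoeffZ mcoeffU.
case: eqVneq => [ij|]; last by rewrite mulr0.
by rewrite -ij iF in jf.
Qed.

Lemma linear_laurent_eq (u v : laurent -> laurent) : linear u -> linear v ->
  (forall j, u << j >> = v << j >>) -> u =1 v.
Proof.
move=> lu lv uv f; rewrite (laurentE f) /linext.
pose U : {linear laurent -> laurent} := HB.pack u (GRing.isLinear.Build k laurent laurent _ u lu).
pose V : {linear laurent -> laurent} := HB.pack v (GRing.isLinear.Build k laurent laurent _ v lv).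
rewrite -[LHS]/(U _) -[RHS]/(V _) !linear_sum; apply: eq_bigr => j _.
by rewrite !linearZ /= uv.
Qed.

Lemma lmul_linear f : linear (lmul f).
Proof.
move=> c g1 g2; rewrite /lmul /linext scaler_sumr -big_split /=.
apply: eq_bigr => i _; rewrite -/(linext _ _) linearP scalerDr scalerA.
by rewrite mulrC -scalerA.
Qed.

Lemma lmulUU i j : lmul << i >> << j >> = << i + j >>.
Proof. by rewrite /lmul !linextU. Qed.

Lemma lmulE f j : lmul f << j >> = linext (fun i => << i + j >>) f.
Proof. by rewrite /lmul /linext; apply: eq_bigr => i _; rewrite -/(linext _ _) linextU. Qed.

Lemma lmul_scale c : lmul (c *: << 0 >>) = *:%R c :> (laurent -> laurent).
Proof.
apply/funext; apply: linear_laurent_eq => [||j].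
- exact: lmul_linear.
- by move=> a f g; rewrite scalerDr !scalerA mulrC.
- by rewrite /lmul linearZ /= linextU linextU add0r.
Qed.

Lemma lmul0 : lmul 0 = 0 :> (laurent -> laurent).
Proof. by apply/funext => f; rewrite /lmul linear0. Qed.

(* Diff(k[t, t^-1]) as the algebra of endomorphisms generated by the
   multiplications and d/dt *)
Inductive is_diffop : (laurent -> laurent) -> Prop :=
| is_diffop_mul f : is_diffop (lmul f)
| is_diffop_der : is_diffop lder
| is_diffop_add u v : is_diffop u -> is_diffop v -> is_diffop (u + v)
| is_diffop_comp u v : is_diffop u -> is_diffop v -> is_diffop (u \o v).

Lemma is_diffop_linear u : is_diffop u -> linear u.
Proof.
elim=> [f||v w _ lv _ lw|v w _ lv _ lw] c x y.
- exact: lmul_linear.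
- exact: linext_linear.
- by rewrite !fctE lv lw scalerDr addrACA.
- by rewrite /= lw lv.
Qed.

Lemma is_diffop_scale c u : is_diffop u -> is_diffop (c *: u).
Proof.
move=> du; have -> : c *: u = lmul (c *: << 0 >>) \o u.
  by rewrite lmul_scale; apply/funext => f.
by apply: is_diffop_comp => //; apply: is_diffop_mul.
Qed.

Lemma is_diffop0 : is_diffop 0.
Proof. by rewrite -lmul0; apply: is_diffop_mul. Qed.

Lemma is_diffop1 : is_diffop id.
Proof.
have -> : id = lmul (1 *: << 0 >>) :> (laurent -> laurent).
  by rewrite lmul_scale; apply/funext => f; rewrite scale1r.
exact: is_diffop_mul.
Qed.

Definition diffop_pred : {pred laurent -> laurent} := fun u => `[< is_diffop u >].

Lemma diffop_submod : submod_closed diffop_pred.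
Proof.
split=> [|c u v]; rewrite !unfold_in; first by apply/asboolP/is_diffop0.
move=> /asboolP du /asboolP dv; apply/asboolP.
by apply: is_diffop_add => //; apply: is_diffop_scale.
Qed.

HB.instance Definition _ :=
  GRing.isSubmodClosed.Build k (laurent -> laurent) diffop_pred diffop_submod.

Record diffT := DiffT { diff_fun :> laurent -> laurent ;
                        _ : diff_fun \in diffop_pred }.
HB.instance Definition _ := [isSub for diff_fun].
HB.instance Definition _ := [Choice of diffT by <:].
HB.instance Definition _ := [SubChoice_isSubLmodule of diffT by <:].

Lemma diffTP (P : diffT) : is_diffop P.
Proof. by case: P => u /= /asboolP. Qed.

Lemma mem_diffop u : is_diffop u -> u \in diffop_pred.
Proof. by move/asboolP. Qed.

Lemma diffT_eq (P Q : diffT) : P =1 Q -> P = Q.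
Proof. by move=> PQ; apply/val_inj/funext. Qed.

Definition diff_one : diffT := DiffT (mem_diffop is_diffop1).
Definition diff_mul (P Q : diffT) : diffT :=
  DiffT (mem_diffop (is_diffop_comp (diffTP P) (diffTP Q))).

Lemma diffTD (P Q : diffT) f : (P + Q) f = P f + Q f. Proof. by []. Qed.
Lemma diffTZ c (P : diffT) f : (c *: P) f = c *: P f. Proof. by []. Qed.

HB.instance Definition _ (P : diffT) :=
  GRing.isLinear.Build k laurent laurent _ P (is_diffop_linear (diffTP P)).

Fact diff_mulA : associative diff_mul. Proof. by move=> P Q S; apply: diffT_eq. Qed.
Fact diff_mul1 : left_id diff_one diff_mul. Proof. by move=> P; apply: diffT_eq. Qed.
Fact diff_mulr1 : right_id diff_one diff_mul. Proof. by move=> P; apply: diffT_eq. Qed.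
Fact diff_mulDl : left_distributive diff_mul +%R.
Proof. by move=> P Q S; apply: diffT_eq. Qed.
Fact diff_mulDr : right_distributive diff_mul +%R.
Proof. by move=> P Q S; apply: diffT_eq => f; rewrite diffTD /= !linearD. Qed.
Fact diff_one_neq0 : diff_one != 0.
Proof.
apply/eqP => e.
have : (diff_one << 0 >>)@_0 = (0 : laurent)@_0 :> k by rewrite e.
by rewrite mcoeff0 mcoeffUU => /eqP; rewrite oner_eq0.
Qed.

HB.instance Definition _ := GRing.Zmodule_isNzRing.Build diffT
  diff_mulA diff_mul1 diff_mulr1 diff_mulDl diff_mulDr diff_one_neq0.

Fact diff_scaleAl c (P Q : diffT) : c *: (P * Q) = c *: P * Q.
Proof. exact: diffT_eq. Qed.
Fact diff_scaleAr c (P Q : diffT) : c *: (P * Q) = P * (c *: Q).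
Proof. by apply: diffT_eq => f; rewrite diffTZ /= linearZ. Qed.

HB.instance Definition _ := GRing.Lmodule_isLalgebra.Build k diffT diff_scaleAl.
HB.instance Definition _ := GRing.Lalgebra_isAlgebra.Build k diffT diff_scaleAr.

Definition Mul f : diffT := DiffT (mem_diffop (is_diffop_mul f)).
Definition Der : diffT := DiffT (mem_diffop is_diffop_der).

Definition diff_order_le (p : nat) (P : diffT) : Prop :=
  exists f : 'I_p.+1 -> laurent, P = \sum_m Mul (f m) * Der ^+ m.

(* t^n (d/dt)^m has degree n - m *)
Definition diff_homog (w : int) (P : diffT) : Prop :=
  exists N (c : 'I_N -> k), P = \sum_m c m *: (Mul << w + m%:Z >> * Der ^+ m).

End Laurent.

Record numsemigroup := NumSemigroup {
  nsg :> {pred nat} ;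
  nsg0 : 0%N \in nsg ;
  nsgD : forall m n, m \in nsg -> n \in nsg -> (m + n)%N \in nsg ;
  nsg_cofinite : finite_set [set n | n \notin nsg]%classic }.

Lemma nsg_large (Gamma : numsemigroup) :
  exists c, forall n, (c <= n)%N -> n \in Gamma.
Proof.
have /finite_fsetP[X eX] := nsg_cofinite Gamma.
exists (\max_(n <- X) n).+1 => n lt; apply/negPn/negP => nG.
have : [set n | n \notin Gamma]%classic n by [].
rewrite eX /= => nX; have := leq_bigmax_seq n (F:=id) nX isT.
by rewrite leqNgt lt.
Qed.

Section MonomialCurve.
Variables (k : numFieldType) (Gamma : numsemigroup).

(* k[Gamma], as a subspace of k[t, t^-1] *)
Definition curve : set (laurent k) := [set f : laurent k |
  forall j, j \in msupp f -> exists2 n, n \in Gamma & j = n%:Z]%classic.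

Lemma curveP f : curve f <->
  forall j, f@_j != 0 -> exists2 n, n \in Gamma & j = n%:Z.
Proof.
by split=> cf j; [rewrite mcoeff_neq0|rewrite -mcoeff_neq0]; apply: cf.
Qed.

Lemma curve_submod c f g : curve f -> curve g -> curve (c *: f + g).
Proof.
move=> /curveP cf /curveP cg; apply/curveP => j; rewrite mcoeffD mcoeffZ.
have [fj|/cf//] := eqVneq f@_j 0; have [gj|/cg//] := eqVneq g@_j 0.
by rewrite fj gj mulr0 addr0 eqxx.
Qed.

Lemma curveU n : n \in Gamma -> curve << n%:Z >>.
Proof.
move=> nG; apply/curveP => j; rewrite mcoeffU.
by case: (eqVneq n%:Z j) => [<- _|_]; [exists n|rewrite eqxx].
Qed.

Definition diff_curve_pred : {pred diffT k} :=
  fun P => `[< forall f, curve f -> curve (P f) >].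

Lemma diff_curve_subalg : subalg_closed diff_curve_pred.
Proof.
split; rewrite ?unfold_in.
- exact/asboolP.
- move=> c P Q; rewrite !unfold_in => /asboolP cP /asboolP cQ; apply/asboolP.
  by move=> f cf; apply: curve_submod; [apply: cP|apply: cQ].
- move=> P Q; rewrite !unfold_in => /asboolP cP /asboolP cQ; apply/asboolP.
  by move=> f cf; apply/cP/cQ.
Qed.

HB.instance Definition _ :=
  GRing.isSubalgClosed.Build k (diffT k) diff_curve_pred diff_curve_subalg.

(* Diff(k[Gamma]), identified with the operators in Diff(k[t, t^-1]) that
   preserve k[Gamma] *)
Record diff_curve := DiffCurve { diff_curve_val :> diffT k ;
                                 _ : diff_curve_val \in diff_curve_pred }.
HB.instance Definition _ := [isSub for diff_curve_val].
HB.instance Definition _ := [Choice of diff_curve by <:].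
HB.instance Definition _ := [SubChoice_isSubAlgebra of diff_curve by <:].

Lemma diff_curveP (P : diff_curve) f : curve f -> curve (diff_curve_val P f).
Proof. by case: P => P /= /asboolP; apply. Qed.

(* The operators of degree w and order at most p, written D_w^p below *)
Definition diff_curve_homog (w : int) (p : nat) : set diff_curve :=
  [set P : diff_curve | diff_homog w P /\ diff_order_le p P]%classic.

(* B^n, the span of the D_w^p with 2p + w <= n *)
Definition bernstein (n : int) : set diff_curve := [set P : diff_curve |
  exists2 s : seq diff_curve, P = \sum_(Q <- s) Q &
    forall Q, Q \in s -> exists (p : nat) (w : int),
      (2 * p)%:Z + w <= n /\ diff_curve_homog w p Q]%classic.

End MonomialCurve.

Section GradedRing.
Variable D : nzRingType.

Definition fprev (V : zmodType) (F : nat -> set V) (n : nat) : set V :=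
  if n is n'.+1 then F n' else [set 0].

(* Positive filtrations, indexed by nat with F_(-1) = 0, whose associated
   graded ring is commutative *)
Record ring_filtration := RingFiltration {
  rfil :> nat -> set D ;
  rfil0 : forall n, rfil n 0 ;
  rfilB : forall n a b, rfil n a -> rfil n b -> rfil n (a - b) ;
  rfilS : forall n a, rfil n a -> rfil n.+1 a ;
  rfil1 : rfil 0 1 ;
  rfilM : forall m n a b, rfil m a -> rfil n b -> rfil (m + n) (a * b) ;
  rfilC : forall m n a b, rfil m a -> rfil n b ->
    fprev rfil (m + n) (a * b - b * a) }.

Variable F : ring_filtration.

Lemma rfil_sum n (I : Type) (r : seq I) (Pr : pred I) (E : I -> D) :
  (forall i, Pr i -> F n (E i)) -> F n (\sum_(i <- r | Pr i) E i).
Proof.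
move=> FE; apply: big_ind => //; first exact: rfil0.
move=> a b Fa Fb; rewrite -[b]opprK; apply: rfilB => //.
by rewrite -sub0r; apply: rfilB => //; apply: rfil0.
Qed.

Lemma rprev0 n : fprev F n 0. Proof. by case: n => [|n] //=; apply: rfil0. Qed.

Lemma rprevB n a b : fprev F n a -> fprev F n b -> fprev F n (a - b).
Proof. by case: n => [-> ->|n] /=; [rewrite subrr|apply: rfilB]. Qed.

Lemma rprev_sum n (I : Type) (r : seq I) (Pr : pred I) (E : I -> D) :
  (forall i, Pr i -> fprev F n (E i)) -> fprev F n (\sum_(i <- r | Pr i) E i).
Proof.
move=> FE; apply: big_ind => //; first exact: rprev0.
move=> a b Fa Fb; rewrite -[b]opprK; apply: rprevB => //.
by rewrite -sub0r; apply: rprevB => //; apply: rprev0.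
Qed.

Lemma rprevMl m n a b : F m a -> fprev F n b -> fprev F (m + n) (a * b).
Proof.
case: n => [|n] Fa /=; first by move=> ->; rewrite mulr0; apply: rprev0.
by rewrite addnS; apply: rfilM.
Qed.

Lemma rprevMr m n a b : fprev F m a -> F n b -> fprev F (m + n) (a * b).
Proof.
case: m => [|m] /=; first by move=> -> _; rewrite mul0r; apply: rprev0.
exact: rfilM.
Qed.

(* gr D is (\bigoplus_n F_n) / (\bigoplus_n F_(n-1)), the multiplication being
   induced by the one of D[h] (an element of F_n is put in degree n) *)
Definition rees_pred : {pred {poly D}} := fun p => `[< forall i, F i p`_i >].

Lemma rees_subring : subring_closed rees_pred.
Proof.
split; rewrite ?unfold_in.
- apply/asboolP => i; rewrite coef1; case: i => [|i] /=; first exact: rfil1.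
  exact: rfil0.
- move=> p q; rewrite !unfold_in => /asboolP Fp /asboolP Fq; apply/asboolP => i.
  by rewrite coefB; apply: rfilB.
- move=> p q; rewrite !unfold_in => /asboolP Fp /asboolP Fq; apply/asboolP => i.
  rewrite coefM; apply: rfil_sum => j _.
  by rewrite -{1}(subnKC (leq_ord j)); apply: rfilM.
Qed.

HB.instance Definition _ :=
  GRing.isSubringClosed.Build {poly D} rees_pred rees_subring.

Record rees := Rees { rees_poly :> {poly D} ; _ : rees_poly \in rees_pred }.
HB.instance Definition _ := [isSub for rees_poly].
HB.instance Definition _ := [Choice of rees by <:].
HB.instance Definition _ := [SubChoice_isSubNzRing of rees by <:].

Lemma reesP (p : rees) i : F i (rees_poly p)`_i.
Proof. by case: p => p /= /asboolP. Qed.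

Definition rees_ideal : {pred rees} :=
  fun p => `[< forall i, fprev F i (rees_poly p)`_i >].

Lemma rees_ideal_zmod : zmod_closed rees_ideal.
Proof.
split; rewrite ?unfold_in.
  by apply/asboolP => i; rewrite /= coef0; apply: rprev0.
move=> p q; rewrite !unfold_in => /asboolP Fp /asboolP Fq; apply/asboolP => i.
by rewrite /= coefB; apply: rprevB.
Qed.

HB.instance Definition _ :=
  GRing.isZmodClosed.Build rees rees_ideal rees_ideal_zmod.

Lemma rees_idealMl (p q : rees) : q \in rees_ideal -> p * q \in rees_ideal.
Proof.
rewrite !unfold_in => /asboolP Iq; apply/asboolP => i; rewrite /= coefM.
apply: rprev_sum => j _; rewrite -{1}(subnKC (leq_ord j)).
by apply: rprevMl => //; apply: reesP.
Qed.

Lemma rees_idealMr (p q : rees) : p \in rees_ideal -> p * q \in rees_ideal.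
Proof.
rewrite !unfold_in => /asboolP Ip; apply/asboolP => i; rewrite /= coefM.
apply: rprev_sum => j _; rewrite -{1}(subnKC (leq_ord j)).
by apply: rprevMr => //; apply: reesP.
Qed.

Lemma rees_idealC (p q : rees) : p * q - q * p \in rees_ideal.
Proof.
rewrite !unfold_in; apply/asboolP => i; rewrite /= coefB coefM coefMr -sumrB.
apply: rprev_sum => j _; rewrite -{1}(subnKC (leq_ord j)).
by apply: rfilC; apply: reesP.
Qed.

Definition gr := Quotient.quot rees_ideal.
HB.instance Definition _ := GRing.Zmodule.on gr.

Definition gr_pi (p : rees) : gr := \pi_gr%qT p.

Lemma gr_piE p q : (gr_pi p = gr_pi q) <-> (p - q \in rees_ideal).
Proof. by rewrite /gr_pi Quotient.idealrBE; split=> [/eqP|/eqP]. Qed.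

Lemma gr_piD p q : gr_pi (p + q) = gr_pi p + gr_pi q.
Proof. exact: Quotient.pi_add. Qed.

Lemma gr_repr (x : gr) : gr_pi (repr x) = x.
Proof. exact: reprK. Qed.

Definition gr_one : gr := gr_pi 1.
Definition gr_mul (x y : gr) : gr := gr_pi (repr x * repr y).

Lemma gr_piM p q : gr_pi (p * q) = gr_mul (gr_pi p) (gr_pi q).
Proof.
apply/gr_piE; set p' := repr _; set q' := repr _.
have Ip : p - p' \in rees_ideal by apply/gr_piE; rewrite gr_repr.
have Iq : q - q' \in rees_ideal by apply/gr_piE; rewrite gr_repr.
have -> : p * q - p' * q' = p * (q - q') + (p - p') * q'.
  by rewrite mulrBr mulrBl addrA subrK.
by apply: rpredD; [apply: rees_idealMl|apply: rees_idealMr].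
Qed.

Fact gr_mulA : associative gr_mul.
Proof.
move=> x y z; rewrite -[x]gr_repr -[y]gr_repr -[z]gr_repr.
by rewrite -!gr_piM mulrA.
Qed.
Fact gr_mulC : commutative gr_mul.
Proof. by move=> x y; apply/gr_piE/rees_idealC. Qed.
Fact gr_mul1 : left_id gr_one gr_mul.
Proof. by move=> x; rewrite -[x]gr_repr -gr_piM mul1r. Qed.
Fact gr_mulDl : left_distributive gr_mul +%R.
Proof.
move=> x y z; rewrite -[x]gr_repr -[y]gr_repr -[z]gr_repr.
by rewrite -gr_piD -!gr_piM mulrDl gr_piD.
Qed.
Fact gr_one_neq0 : gr_one != 0.
Proof.
apply/eqP => e; have : gr_one = gr_pi 0.
  by rewrite e; apply: (addIr (gr_pi 0)); rewrite -gr_piD !add0r.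
move/gr_piE; rewrite subr0 unfold_in => /asboolP /(_ 0%N) /=.
by rewrite coef1 /= => /eqP; rewrite oner_eq0.
Qed.

HB.instance Definition _ := GRing.Zmodule_isComNzRing.Build gr
  gr_mulA gr_mulC gr_mul1 gr_mulDl gr_one_neq0.

End GradedRing.

Arguments rees_ideal {D} F _.

Section GradedModule.
Variables (k : fieldType) (D : algType k) (F : ring_filtration D).
Variable M : lmodType D.

(* M is a k-vector space through k -> D, c |-> c%:A *)
Record mod_filtration := ModFiltration {
  mfil :> nat -> set M ;
  mfil0 : forall n, mfil n 0 ;
  mfilD : forall n x y, mfil n x -> mfil n y -> mfil n (x + y) ;
  mfilZ : forall n (c : k) x, mfil n x -> mfil n ((c%:A : D) *: x) ;
  mfilS : forall n x, mfil n x -> mfil n.+1 x ;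
  mfilT : forall x, exists n, mfil n x ;
  mfilM : forall m n a x, F m a -> mfil n x -> mfil (m + n) (a *: x) }.

Variable G : mod_filtration.

Lemma mfilN n x : G n x -> G n (- x).
Proof. by move/(mfilZ (-1)); rewrite !scaleN1r. Qed.

Lemma mprev0 n : fprev G n 0. Proof. by case: n => [|n] //=; apply: mfil0. Qed.

Lemma mprevD n x y : fprev G n x -> fprev G n y -> fprev G n (x + y).
Proof. by case: n => [-> ->|n] /=; [rewrite addr0|apply: mfilD]. Qed.

Lemma mprevN n x : fprev G n x -> fprev G n (- x).
Proof. by case: n => [->|n] /=; [rewrite oppr0|apply: mfilN]. Qed.

Lemma mfil_sum n (I : Type) (r : seq I) (Pr : pred I) (E : I -> M) :
  (forall i, Pr i -> G n (E i)) -> G n (\sum_(i <- r | Pr i) E i).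
Proof. by move=> GE; apply: big_ind => //; [apply: mfil0|apply: mfilD]. Qed.

Lemma mprev_sum n (I : Type) (r : seq I) (Pr : pred I) (E : I -> M) :
  (forall i, Pr i -> fprev G n (E i)) -> fprev G n (\sum_(i <- r | Pr i) E i).
Proof. by move=> GE; apply: big_ind => //; [apply: mprev0|apply: mprevD]. Qed.

Lemma mprevMl m n a x : F m a -> fprev G n x -> fprev G (m + n) (a *: x).
Proof.
case: n => [|n] Fa /=; first by move=> ->; rewrite scaler0; apply: mprev0.
by rewrite addnS; apply: mfilM.
Qed.

Lemma mprevMr m n a x : fprev F m a -> G n x -> fprev G (m + n) (a *: x).
Proof.
case: m => [|m] /=; first by move=> -> _; rewrite scale0r; apply: mprev0.
exact: mfilM.
Qed.

(* As for rings, gr M is (\bigoplus_n M_n) / (\bigoplus_n M_(n-1)) *)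
Definition mrees_pred : {pred nat -> M} := fun u =>
  `[< (forall n, G n (u n)) /\ exists N, forall n, (N <= n)%N -> u n = 0 >].

Lemma mrees_zmod : zmod_closed mrees_pred.
Proof.
split; rewrite ?unfold_in.
  by apply/asboolP; split=> [n|]; [apply: mfil0|exists 0%N].
move=> u v; rewrite !unfold_in => /asboolP[Gu [N uN]] /asboolP[Gv [N' vN']].
apply/asboolP; split=> [n|]; first by apply: mfilD => //; apply: mfilN.
exists (maxn N N') => n; rewrite geq_max => /andP[Nn N'n].
by rewrite !fctE uN // vN' // subr0.
Qed.

HB.instance Definition _ :=
  GRing.isZmodClosed.Build (nat -> M) mrees_pred mrees_zmod.

Record mrees := MRees { mrees_fun :> nat -> M ; _ : mrees_fun \in mrees_pred }.
HB.instance Definition _ := [isSub for mrees_fun].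
HB.instance Definition _ := [Choice of mrees by <:].
HB.instance Definition _ := [SubChoice_isSubZmodule of mrees by <:].

Lemma mreesP (u : mrees) n : G n (u n).
Proof. by case: u => u /= /asboolP[]. Qed.

Lemma mrees_eq (u v : mrees) : u =1 v -> u = v.
Proof. by move=> uv; apply/val_inj/funext. Qed.

Definition mrees_ideal : {pred mrees} :=
  fun u => `[< forall n, fprev G n (u n) >].

Lemma mrees_ideal_zmod : zmod_closed mrees_ideal.
Proof.
split; rewrite ?unfold_in.
  by apply/asboolP => n; apply: mprev0.
move=> u v; rewrite !unfold_in => /asboolP Gu /asboolP Gv; apply/asboolP => n.
by apply: mprevD => //; apply: mprevN.
Qed.

HB.instance Definition _ :=
  GRing.isZmodClosed.Build mrees mrees_ideal mrees_ideal_zmod.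

Definition ract_fun (p : rees F) (u : mrees) (n : nat) : M :=
  \sum_(i < n.+1) (rees_poly p)`_i *: u (n - i)%N.

Lemma ract_subproof p u : ract_fun p u \in mrees_pred.
Proof.
rewrite unfold_in; apply/asboolP; split=> [n|].
  apply: mfil_sum => i _; rewrite -{1}(subnKC (leq_ord i)).
  by apply: mfilM; [apply: reesP|apply: mreesP].
case: u => u /= uP; have /asboolP[_ [N uN]] := uP.
exists (size (rees_poly p) + N)%N => n le_n; rewrite /ract_fun big1 // => i _ /=.
have [lti|lei] := ltnP i (size (rees_poly p)); last by rewrite nth_default // scale0r.
rewrite uN ?scaler0 // leq_subRL; last exact: leq_ord.
by apply: leq_trans le_n; rewrite leq_add2r ltnW.
Qed.

Definition ract p u : mrees := MRees (ract_subproof p u).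

Lemma ractDl p q u : ract (p + q) u = ract p u + ract q u.
Proof.
apply: mrees_eq => n; rewrite -[RHS]/(ract_fun p u n + ract_fun q u n) /= /ract_fun.
by rewrite -big_split; apply: eq_bigr => i _; rewrite /= coefD scalerDl.
Qed.

Lemma ractDr p u v : ract p (u + v) = ract p u + ract p v.
Proof.
apply: mrees_eq => n; rewrite -[RHS]/(ract_fun p u n + ract_fun p v n) /= /ract_fun.
by rewrite -big_split; apply: eq_bigr => i _; rewrite /= -scalerDr.
Qed.

Lemma ract1 u : ract 1 u = u.
Proof.
apply: mrees_eq => n; rewrite /= /ract_fun big_ord_recl /= coef1 scale1r subn0.
by rewrite big1 ?addr0 // => i _; rewrite /= coef1 scale0r.
Qed.

Lemma ractM p q u : ract (p * q) u = ract p (ract q u).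
Proof.
apply: mrees_eq => n; rewrite /= /ract_fun /=.
pose E i j := ((rees_poly p)`_i * (rees_poly q)`_j) *: u (n - (i + j))%N.
transitivity (\sum_(l < n.+1) \sum_(i < n.+1 | (i <= l)%N) E i (l - i)%N).
  apply: eq_bigr => l _; rewrite coefM scaler_suml.
  rewrite (big_ord_narrow_leq (leq_ord l)) /=; apply: eq_bigr => i _.
  by rewrite /E subnKC // leq_ord.
rewrite (exchange_big_dep xpredT) //=; apply: eq_bigr => i _.
rewrite scaler_sumr.
rewrite (reindex_omap (fun j : 'I_(n - i).+1 => inord (i + j)%N : 'I_n.+1)
   (fun l : 'I_n.+1 => insub (l - i)%N)) /=; last first.
  move=> l il; rewrite insubT /= ?ltnS ?leq_sub2r ?leq_ord // => lt.
  by congr Some; apply: val_inj; rewrite /= inordK subnKC.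
have ij (j : 'I_(n - i).+1) : (i + j < n.+1)%N.
  by rewrite ltnS -leq_subRL ?leq_ord.
apply: eq_big => [j|j _].
  rewrite inordK // leq_addr addKn; case: insubP => [v _ vj|].
    by rewrite (_ : v = j) ?eqxx //; apply: val_inj.
  by rewrite ltn_ord.
by rewrite /E inordK // addKn scalerA subnDA.
Qed.

Lemma ract_idealr p u : u \in mrees_ideal -> ract p u \in mrees_ideal.
Proof.
rewrite !unfold_in => /asboolP Iu; apply/asboolP => n; apply: mprev_sum => i _.
by rewrite -{1}(subnKC (leq_ord i)); apply: mprevMl => //; apply: reesP.
Qed.

Lemma ract_ideall p u : p \in rees_ideal F -> ract p u \in mrees_ideal.
Proof.
rewrite !unfold_in => /asboolP Ip; apply/asboolP => n; apply: mprev_sum => i _.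
by rewrite -{1}(subnKC (leq_ord i)); apply: mprevMr => //; apply: mreesP.
Qed.

Definition grmod := Quotient.quot mrees_ideal.
HB.instance Definition _ := GRing.Zmodule.on grmod.

Definition grmod_pi (u : mrees) : grmod := \pi_grmod%qT u.

Lemma grmod_piE u v : (grmod_pi u = grmod_pi v) <-> (u - v \in mrees_ideal).
Proof. by rewrite /grmod_pi Quotient.idealrBE; split=> [/eqP|/eqP]. Qed.

Lemma grmod_piD u v : grmod_pi (u + v) = grmod_pi u + grmod_pi v.
Proof. exact: Quotient.pi_add. Qed.

Lemma grmod_repr (x : grmod) : grmod_pi (repr x) = x.
Proof. exact: reprK. Qed.

Definition grmod_scale (a : gr F) (x : grmod) : grmod :=
  grmod_pi (ract (repr a) (repr x)).

Lemma grmod_piZ p u : grmod_pi (ract p u) = grmod_scale (gr_pi p) (grmod_pi u).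
Proof.
apply/grmod_piE; set p' := repr _; set u' := repr _.
have Ip : p - p' \in rees_ideal F by apply/gr_piE; rewrite gr_repr.
have Iu : u - u' \in mrees_ideal by apply/grmod_piE; rewrite grmod_repr.
rewrite -[p](subrK p') ractDl -[X in ract p' X](subrK u') ractDr addrA addrK.
by apply: rpredD; [apply: ract_ideall|apply: ract_idealr].
Qed.

Fact grmod_scaleA a b x : grmod_scale a (grmod_scale b x) = grmod_scale (a * b) x.
Proof.
rewrite -[a]gr_repr -[b]gr_repr -[x]grmod_repr.
by rewrite -[_ * _]gr_piM -!grmod_piZ ractM.
Qed.
Fact grmod_scale1 : left_id 1 grmod_scale.
Proof. by move=> x; rewrite -[x]grmod_repr -grmod_piZ ract1. Qed.
Fact grmod_scaleDr : right_distributive grmod_scale +%R.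
Proof.
move=> a x y; rewrite -[a]gr_repr -[x]grmod_repr -[y]grmod_repr.
by rewrite -grmod_piD -!grmod_piZ ractDr grmod_piD.
Qed.
Fact grmod_scaleDl x : {morph grmod_scale^~ x : a b / a + b}.
Proof.
move=> a b; rewrite -[a]gr_repr -[b]gr_repr -[x]grmod_repr.
by rewrite -gr_piD -!grmod_piZ ractDl grmod_piD.
Qed.

HB.instance Definition _ := GRing.Zmodule_isLmodule.Build (gr F) grmod
  grmod_scaleA grmod_scale1 grmod_scaleDr grmod_scaleDl.

End GradedModule.

Definition fin_gen (R : nzRingType) (V : lmodType R) : Prop :=
  exists N (v : 'I_N -> V), forall x, exists a : 'I_N -> R,
    x = \sum_i a i *: v i.

(* p_0 < ... < p_n, prime ideals containing the annihilator of V *)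
Definition prime_chain (R : comNzRingType) (V : lmodType R) (n : nat)
    (p : 'I_n.+1 -> prime_idealr R) : Prop :=
  (forall i a, (forall v : V, a *: v = 0) -> a \in p i) /\
  (forall i j : 'I_n.+1, (i < j)%N ->
     {subset p i <= p j} /\ exists2 a, a \in p j & a \notin p i).

(* The Krull dimension of the module V is that of the ring R / Ann V *)
Definition krull_dim (R : comNzRingType) (V : lmodType R) (d : nat) : Prop :=
  (exists p, @prime_chain R V d p) /\
  (forall n p, @prime_chain R V n p -> (n <= d)%N).

Definition dim_eq (k : fieldType) (D : algType k) (M : lmodType D) (U : set M)
    (N : nat) : Prop :=
  exists v : 'I_N -> M,
    [/\ forall i, U (v i),
        forall x, U x -> exists c : 'I_N -> k, x = \sum_i ((c i)%:A : D) *: v i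
      & forall c : 'I_N -> k, \sum_i ((c i)%:A : D) *: v i = 0 ->
          forall i, c i = 0].

Definition good_filtration (k : fieldType) (D : algType k)
    (F : ring_filtration D) (M : lmodType D) (G : mod_filtration F M) : Prop :=
  fin_gen (grmod G).

Section NormalForm.
Variable k : numFieldType.
Implicit Types (P Q : diffT k) (f g : {poly k}) (i j w v : int).

(* P t^j = f(j) t^(j + w), i.e., P = t^w f(t d/dt) *)
Definition acts_by P w f := forall j, P << j >> = f.[j%:~R] *: << j + w >>.

Definition ffact_poly m : {poly k} := \prod_(i < m) ('X - (i%:R)%:P).

Lemma Der_powU m j :
  (Der k ^+ m : diffT k) << j >> = (ffact_poly m).[j%:~R] *: << j - m%:Z >>.
Proof.
elim: m => [|m IHm].
  by rewrite /ffact_poly big_ord0 hornerE scale1r subr0.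
rewrite exprS -[LHS]/(lder ((Der k ^+ m : diffT k) << j >>)) IHm.
rewrite /lder linearZ /= linextU scalerA; congr (_ *: << _ >>).
  rewrite /ffact_poly big_ord_recr /= hornerM; congr (_ * _).
  by rewrite !hornerE rmorphB.
by rewrite -addn1 PoszD opprD addrA.
Qed.

Lemma MulDerU (h : laurent k) m j :
  (Mul h * Der k ^+ m : diffT k) << j >> =
  (ffact_poly m).[j%:~R] *: linext (fun i => << i + (j - m%:Z) >>) h.
Proof.
rewrite -[LHS]/(lmul h ((Der k ^+ m : diffT k) << j >>)) Der_powU.
by have /scalable_linear -> := @lmul_linear k h; rewrite /= lmulE.
Qed.

Lemma diffTE_sum (I : Type) (r : seq I) (Pr : pred I) (E : I -> diffT k) h :
  (\sum_(i <- r | Pr i) E i : diffT k) h = \sum_(i <- r | Pr i) E i h.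
Proof. by apply: (big_morph (fun P : diffT k => P h)). Qed.

Lemma linext_shift_coef (h : laurent k) j l :
  (linext (fun i => << i + j >>) h : laurent k)@_(l + j) = h@_l.
Proof.
rewrite [in RHS](laurentE h) /linext !raddf_sum /=.
apply: eq_bigr => i _; rewrite !mcoeffZ !mcoeffU.
by rewrite (inj_eq (addIr j)).
Qed.

Lemma homog_acts P w p : diff_homog w P -> diff_order_le p P ->
  exists2 f, acts_by P w f & (size f <= p.+1)%N.
Proof.
case=> N [c eP] [h eP'].
exists (\sum_(m < p.+1) (h m)@_(w + m%:Z) *: ffact_poly m); last first.
  apply: (leq_trans (size_sum _ _ _)); apply/bigmax_leqP => m _.
  apply: (leq_trans (size_scale_leq _ _)).
  by rewrite /ffact_poly size_prod_XsubC; rewrite -/(index_enum _) /index_enum -enumT size_enum_ord ltn_ord.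
have hP j : P << j >> = (P << j >>)@_(j + w) *: << j + w >>.
  suff [a ->] : exists a, P << j >> = a *: << j + w >>.
    by rewrite mcoeffZ mcoeffUU mulr1.
  exists (\sum_m c m * (ffact_poly m).[j%:~R]).
  rewrite eP diffTE_sum scaler_suml; apply: eq_bigr => m _.
  rewrite diffTZ MulDerU linextU scalerA; congr (_ *: << _ >>).
  by rewrite addrACA subrr addr0 addrC.
move=> j; rewrite hP; congr (_ *: _).
rewrite eP' diffTE_sum raddf_sum horner_sum; apply: eq_bigr => m _.
rewrite MulDerU [LHS]mcoeffZ hornerZ mulrC; congr (_ * _).
have -> : j + w = w + m%:Z + (j - m%:Z) by rewrite addrACA subrr addr0 addrC.
exact: linext_shift_coef.
Qed.

Lemma ffact_basis p f : (size f <= p)%N ->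
  exists c : 'I_p -> k, f = \sum_m c m *: ffact_poly m.
Proof.
elim: p f => [|p IHp] f sf.
  exists (fun _ => 0); rewrite big_ord0.
  by apply/eqP; rewrite -size_poly_leq0.
have sfp m : size (ffact_poly m) = m.+1.
  by rewrite /ffact_poly size_prod_XsubC -/(index_enum _) /index_enum -enumT size_enum_ord.
have mon : (ffact_poly p)`_p = 1.
  have : ffact_poly p \is monic by apply: monic_prod_XsubC.
  by rewrite monicE /lead_coef sfp => /eqP.
have [|c ec] := IHp (f - f`_p *: ffact_poly p).
  apply/leq_sizeP => j pj; rewrite coefB coefZ.
  have [<-|ne] := eqVneq p j; first by rewrite mon mulr1 subrr.
  have lt : (p < j)%N by rewrite ltn_neqAle ne.
  rewrite (@nth_default _ _ f j) ?(leq_trans sf) //.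
  by rewrite (@nth_default _ _ (ffact_poly p) j) ?sfp // mulr0 subr0.
exists (fun m : 'I_p.+1 => if insub (m : nat) is Some m' then c m' else f`_p).
rewrite big_ord_recr /= insubF ?ltnn // -[LHS](subrK (f`_p *: ffact_poly p)) ec.
by congr (_ + _); apply: eq_bigr => m _; rewrite /= valK.
Qed.

Lemma acts_homog P w p f : acts_by P w f -> (size f <= p.+1)%N ->
  diff_homog w P /\ diff_order_le p P.
Proof.
move=> Pf /ffact_basis[c ec].
have eP : P = \sum_m c m *: (Mul << w + m%:Z >> * Der k ^+ m).
  apply: diffT_eq; apply: linear_laurent_eq; try exact/is_diffop_linear/diffTP.
  move=> j; rewrite Pf ec diffTE_sum horner_sum scaler_suml.
  apply: eq_bigr => m _; rewrite diffTZ MulDerU linextU scalerA hornerZ.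
  by congr (_ *: << _ >>); rewrite addrACA subrr addr0 addrC.
split; first by exists p.+1, c.
exists (fun m => c m *: << w + m%:Z >>); rewrite eP; apply: eq_bigr => m _.
rewrite scalerAl; congr (_ * _); apply: diffT_eq => g.
by rewrite diffTZ /= /lmul linearZ.
Qed.

Lemma acts_by_mul P Q w v f g : acts_by P w f -> acts_by Q v g ->
  acts_by (P * Q) (w + v) ((f \Po ('X + (v%:~R)%:P)) * g).
Proof.
move=> Pf Qg j; rewrite -[LHS]/(P (Q << j >>)) Qg linearZ /= Pf scalerA.
rewrite hornerM horner_comp !hornerE -rmorphD mulrC; congr (_ *: << _ >>).
exact: addrAC.
Qed.

Lemma acts_by_sub P Q w f g : acts_by P w f -> acts_by Q w g ->
  acts_by (P - Q) w (f - g).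
Proof.
move=> Pf Qg j; rewrite -[LHS]/(P << j >> - Q << j >>) Pf Qg.
by rewrite -scalerBl !hornerE.
Qed.

Lemma size_shift f (a : k) : (size (f \Po ('X + a%:P) - f)%R <= (size f).-1)%N.
Proof.
elim/poly_ind: f => [|f c IHf]; first by rewrite comp_poly0 subr0 size_poly0.
rewrite size_MXaddC; case: eqVneq => [->|f0] /=.
  by rewrite mul0r add0r comp_polyC subrr size_poly0; case: ifP.
rewrite comp_poly_MXaddC opprD addrACA subrr addr0 mulrDr addrAC -mulrBl.
apply: (leq_trans (size_polyD _ _)); rewrite geq_max; apply/andP; split.
  have [->|nz] := eqVneq (f \Po ('X + a%:P) - f) 0; first by rewrite mul0r size_poly0.
  rewrite size_mulX //; apply: (leq_ltn_trans IHf).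
  by rewrite prednK // size_poly_gt0.
rewrite mulrC mul_polyC; apply: (leq_trans (size_scale_leq _ _)).
by rewrite size_comp_poly2 // size_XaddC.
Qed.

Lemma acts_by_comm P Q w v f g p q : acts_by P w f -> acts_by Q v g ->
  (size f <= p.+1)%N -> (size g <= q.+1)%N ->
  exists2 h, acts_by (P * Q - Q * P) (w + v) h & (size h <= p + q)%N.
Proof.
move=> Pf Qg sf sg; have PQ := acts_by_mul Pf Qg; have := acts_by_mul Qg Pf.
rewrite addrC => /(acts_by_sub PQ) => PQQP; eexists; first exact: PQQP.
set f' := f \Po _; set g' := g \Po _.
have -> : f' * g - g' * f = (f' - f) * g - (g' - g) * f.
  by rewrite !mulrBl opprB addrA [f * g]mulrC addrNK.
have sM (a b : {poly k}) m n : (size a <= m)%N -> (size b <= n.+1)%N ->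
    (size (a * b)%R <= m + n)%N.
  move=> sa sb; apply: (leq_trans (size_polyMleq _ _)).
  by rewrite -ltnS; case: (size a + size b)%N (leq_add sa sb) => [|x]; rewrite addnS.
apply: (leq_trans (size_polyD _ _)); rewrite size_polyN geq_max; apply/andP; split.
  apply: sM sg; apply: (leq_trans (size_shift _ _)).
  by rewrite -ltnS; case: (size f) sf.
rewrite addnC; apply: sM sf; apply: (leq_trans (size_shift _ _)).
by rewrite -ltnS; case: (size g) sg.
Qed.

End NormalForm.

Section Bernstein.
Variables (k : numFieldType) (Gamma : numsemigroup).
Local Notation D := (diff_curve k Gamma).
Local Notation B := (@bernstein k Gamma).
Implicit Types (P Q : D) (w v n m : int) (p q : nat).

Lemma homog_curveP w p P : diff_curve_homog w p P <->
  exists2 f, acts_by P w f & (size f <= p.+1)%N.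
Proof.
split=> [[wP pP]|[f Pf sf]]; first exact: homog_acts wP pP.
exact: acts_homog Pf sf.
Qed.

Lemma diff_curve_eq0 w p P : diff_curve_homog w p P -> (2 * p)%:Z + w < 0 -> P = 0.
Proof.
move=> /homog_curveP[f Pf sf] neg.
have [v v0 ev] : exists2 v : nat, (p < v)%N & w = - v%:Z.
  case: w neg {Pf} => w; first by rewrite ltNge addr_ge0.
  rewrite NegzE => neg; exists w.+1 => //.
  move: neg; rewrite subr_lt0 ltz_nat; apply: leq_ltn_trans.
  by rewrite mul2n -addnn leq_addr.
have v_gt0 : (0 < v)%N by apply: leq_ltn_trans v0.
have ex r : exists j, (j \in Gamma) && (j == r %[mod v]).
  have [c Gc] := nsg_large Gamma.
  exists (c * v + r)%N; rewrite modnMDl eqxx andbT Gc //.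
  by apply: leq_trans (leq_addr _ _); rewrite leq_pmulr.
pose jr r := ex_minn (ex r).
have f0 r : f.[(jr r)%:R] = 0.
  rewrite /jr; case: ex_minnP => j /andP[jG /eqP jr_mod] jmin.
  have := @diff_curveP _ _ P _ (@curveU k _ _ jG); rewrite Pf ev => /curveP/(_ (j%:Z - v%:Z)).
  rewrite mcoeffZ mcoeffUU mulr1 -[j%:~R]/(j%:R : k) => H; apply/eqP/negPn/negP => /H.
  case=> n nG jvn; have ej : j = (n + v)%N.
    by apply/eqP; rewrite -eqz_nat PoszD -jvn subrK.
  have : (j <= n)%N by apply: jmin; rewrite nG -jr_mod ej modnDr eqxx.
  by rewrite leqNgt ej -addn1 leq_add2l v_gt0.
have fz : f = 0.
  apply/eqP/negPn/negP => fn0.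
  have := @max_poly_roots _ f [seq (jr r)%:R | r <- iota 0 v] fn0.
  rewrite size_map size_iota => H.
  have : (v < size f)%N.
    apply: H; first by apply/allP => _ /mapP[r _ ->]; apply/rootP.
    rewrite map_inj_in_uniq ?iota_uniq // => r s.
    rewrite !mem_iota /= !add0n => rv sv /eqP; rewrite eqr_nat => /eqP e.
    have jm t : jr t = t %[mod v].
      by rewrite /jr; case: ex_minnP => j /andP[_ /eqP].
    by have := jm s; rewrite -e jm !modn_small.
  by rewrite ltnNge (leq_trans sf).
apply/val_inj/diffT_eq/linear_laurent_eq; try exact/is_diffop_linear/diffTP.
by move=> j; rewrite Pf fz horner0 scale0r.
Qed.

Lemma bernstein0 n : B n 0.
Proof. by exists [::]; rewrite ?big_nil. Qed.

Lemma bernsteinD n P Q : B n P -> B n Q -> B n (P + Q).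
Proof.
move=> [s -> sn] [r -> rn]; exists (s ++ r); first by rewrite big_cat.
by move=> S; rewrite mem_cat => /orP[/sn|/rn].
Qed.

Lemma bernsteinU n p w P : (2 * p)%:Z + w <= n -> diff_curve_homog w p P -> B n P.
Proof.
move=> le hP; exists [:: P]; first by rewrite big_seq1.
by move=> Q; rewrite inE => /eqP ->; exists p, w.
Qed.

Lemma bernstein_sum n (s : seq D) (E : D -> D) :
  (forall Q, Q \in s -> B n (E Q)) -> B n (\sum_(Q <- s) E Q).
Proof.
move=> sE; rewrite big_seq; apply: big_ind => //; first exact: bernstein0.
exact: bernsteinD.
Qed.

Lemma bernstein_le m n P : m <= n -> B m P -> B n P.
Proof.
move=> le [s -> sm]; exists s => // Q /sm[p [w [pw hQ]]].
by exists p, w; split=> //; apply: le_trans le.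
Qed.

Lemma bernsteinN n P : B n P -> B n (- P).
Proof.
move=> [s -> sn]; rewrite -sumrN; apply: bernstein_sum => Q /sn[p [w [pw]]].
move=> /homog_curveP[f Qf sf]; apply: (bernsteinU pw); apply/homog_curveP.
exists (- f); last by rewrite size_polyN.
by move=> j; rewrite -[LHS]/(- (diff_curve_val Q << j >>)) Qf hornerN scaleNr.
Qed.

Lemma bernstein_lt0 n P : n < 0 -> B n P -> P = 0.
Proof.
move=> n0 [s -> sn]; rewrite big_seq big1 // => Q /sn[p [w [pw hQ]]].
by apply: (diff_curve_eq0 hQ); apply: le_lt_trans n0.
Qed.

Lemma bernstein1 : B 0 1.
Proof.
apply: (@bernsteinU 0 0 0) => //; apply/homog_curveP; exists 1.
  by move=> j; rewrite hornerC scale1r addr0.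
by rewrite size_poly1.
Qed.

Lemma bernsteinM m n P Q : B m P -> B n Q -> B (m + n) (P * Q).
Proof.
move=> [s -> sm] [r -> rn]; rewrite mulr_suml; apply: bernstein_sum => P' /sm.
move=> [p [w [pw /homog_curveP[f Pf sf]]]].
rewrite mulr_sumr; apply: bernstein_sum => Q' /rn.
move=> [q [v [qv /homog_curveP[g Qg sg]]]].
apply: (@bernsteinU _ (p + q) (w + v)).
  by rewrite mulnDr PoszD addrACA lerD.
apply/homog_curveP; eexists; first exact: acts_by_mul Pf Qg.
apply: (leq_trans (size_polyMleq _ _)); rewrite size_comp_poly2 ?size_XaddC //.
by have := leq_add sf sg; rewrite addSn addnS; case: (_ + _)%N.
Qed.

Lemma bernsteinC m n P Q : B m P -> B n Q -> B (m + n - 2) (P * Q - Q * P).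
Proof.
move=> [s -> sm] [r -> rn].
rewrite mulr_suml mulr_sumr -sumrB; apply: bernstein_sum => P' /sm.
move=> [p [w [pw /homog_curveP[f Pf sf]]]].
rewrite mulr_suml mulr_sumr -sumrB; apply: bernstein_sum => Q' /rn.
move=> [q [v [qv /homog_curveP[g Qg sg]]]].
have [h Ph sh] := acts_by_comm Pf Qg sf sg.
case e : (p + q)%N sh => [|x] sh.
  suff -> : P' * Q' - Q' * P' = 0 by apply: bernstein0.
  apply/val_inj/diffT_eq/linear_laurent_eq; try exact/is_diffop_linear/diffTP.
  move=> j; rewrite [LHS]Ph; move: sh; rewrite leqn0 size_poly_eq0 => /eqP ->.
  by rewrite horner0 scale0r.
apply: (@bernsteinU _ x (w + v)); last by apply/homog_curveP; exists h.
rewrite lerBrDr; have := lerD pw qv; apply: le_trans.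
have e2 : (2 * p)%:Z + (2 * q)%:Z = (2 * x)%:Z + 2.
  by rewrite -[LHS]PoszD -mulnDr e mulnS addnC PoszD.
by rewrite [leRHS]addrACA e2 addrAC.
Qed.

Definition bernstein_set (n : nat) : set D := B n%:Z.

Lemma bernstein_setB (n : nat) P Q :
  bernstein_set n P -> bernstein_set n Q -> bernstein_set n (P - Q).
Proof. by move=> BP BQ; apply: bernsteinD => //; apply: bernsteinN. Qed.

Lemma bernstein_setS (n : nat) P : bernstein_set n P -> bernstein_set n.+1 P.
Proof. by apply: bernstein_le; rewrite lez_nat. Qed.

Lemma bernstein_setM (m n : nat) P Q :
  bernstein_set m P -> bernstein_set n Q -> bernstein_set (m + n) (P * Q).
Proof. by rewrite /bernstein_set PoszD; apply: bernsteinM. Qed.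

Lemma bernstein_setC (m n : nat) P Q : bernstein_set m P -> bernstein_set n Q ->
  fprev bernstein_set (m + n) (P * Q - Q * P).
Proof.
move=> BP BQ; have := bernsteinC BP BQ; rewrite -PoszD.
case: (m + n)%N => [|x] /=; first by move/bernstein_lt0; apply.
by apply: bernstein_le; rewrite -addn1 PoszD -addrA gerDl.
Qed.

(* Nothing is lost by indexing with nat: B^n = 0 for n < 0 by bernstein_lt0 *)
Definition bernstein_filtration : ring_filtration D :=
  @RingFiltration D bernstein_set (fun n : nat => bernstein0 n%:Z) bernstein_setB
    bernstein_setS bernstein1 bernstein_setM bernstein_setC.

End Bernstein.

(* Main.v *)
Require Import Defs.
From HB Require Import structures.
From mathcomp Require Import all_boot all_order all_algebra.
From mathcomp Require Import boolp classical_sets functions.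
From mathcomp Require Import finmap zify ring.
From mathcomp Require Import reals complex.
From mathcomp.multinomials Require Import monalg.

Set Implicit Arguments.
Unset Strict Implicit.
Unset Printing Implicit Defensive.

Import Order.TTheory GRing.Theory Num.Theory.
Local Open Scope ring_scope.

(** Let x and y be the symbols of t and d/dt, and theta = t d/dt.  An operator
    of degree w acts by t^j |-> f(j) t^(j + w) for a polynomial f, that is, it
    is t^w f(theta).  The f that occur form the ideal of k[theta] of the
    polynomials that vanish at the exponents j of Gamma with j + w outside
    Gamma.  Counting these exponents shows that gr D is a graded subring of
    k[x, y], with x and y in degree 1, that contains all forms of large
    degree.  A form of degree n is represented by its dehomogenization, a
    polynomial of size at most n + 1 in y.  The symbol map [sigma n] on B^n
    has the kernel B^(n-1) ([sigma_ker]), it is multiplicative ([sigmaM]) and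
    onto for large n ([sigma_onto]).  Together these maps embed gr D in
    k[y][h] ([phi]).

    Hilbert function.  Homogeneous generators of gr M filter it by cyclic
    modules gr D / U, where U is a graded ideal.  If U = 0 the dimension of
    the part of degree n is n + 1 for large n.  If U contains a form u of
    degree n <> 0, multiplying the elements of U_n by all forms of degree c
    raises the dimension by at least c, so that dim (gr D / U)_(n + c) <=
    dim (gr D / U)_n for every large c: a sequence of natural numbers with
    this property is eventually constant ([quotient_dim_eventually]).  Hence
    dim M_n - dim M_(n-1) is eventually u n + v, where u is the number of
    cyclic factors with U = 0, and dim M_n is eventually a polynomial in n,
    so that one residue class (m = 1) is enough.  Its degree d is 2 if u > 0,
    1 if u = 0 < v, and 0 otherwise; its leading coefficient is e / d! with
    e = u, v or dim M.

    Krull dimension.  For the upper bound, take a chain p_0 < ... < p_n of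
    primes above the annihilator and a_i in p_i but not in p_(i-1).  The
    monomials in the a_i are linearly independent modulo p_0
    ([chain_independent]), hence modulo the annihilator.  As gr M is finitely
    generated, T^n independent monomials of degree at most K T force
    T^n <= C T^d for all T, so that n <= d ([krull_dim_le]).

    For the lower bound, chains are written down.  The ideal of the elements
    without constant term contains the annihilator because M <> 0.  If u > 0
    the annihilator is zero, and 0 < (y) < (x, y) restricts to a chain in
    gr D.  If u = 0 < v, a factor gr D / U is infinite dimensional; since k is
    algebraically closed, all the forms in U then vanish at a point of the
    projective line ([gideal_common_zero]), and the ideal of this point lies
    strictly below (x, y). *)

(** * Relative dimension of two subspaces *)

Section RelativeDimension.
Variables (k : fieldType) (V : lmodType k).
Implicit Types (U W Z : set V).

Definition subspace U := U 0 /\ forall c x y, U x -> U y -> U (c *: x + y).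

Lemma subspaceD U x y : subspace U -> U x -> U y -> U (x + y).
Proof. by move=> [_ UL] Ux Uy; rewrite -[x]scale1r; apply: UL. Qed.

Lemma subspaceZ U c x : subspace U -> U x -> U (c *: x).
Proof. by move=> [U0 UL] Ux; rewrite -[_ *: _]addr0; apply: UL. Qed.

Lemma subspaceB U x y : subspace U -> U x -> U y -> U (x - y).
Proof.
by move=> sU Ux Uy; apply: subspaceD => //; rewrite -scaleN1r; apply: subspaceZ.
Qed.

Lemma subspace_sum U (I : Type) (r : seq I) (P : pred I) (E : I -> V) :
  subspace U -> (forall i, P i -> U (E i)) -> U (\sum_(i <- r | P i) E i).
Proof.
move=> sU UE; apply: big_ind => //; first by case: sU.
by move=> x y; apply: subspaceD.
Qed.

(** The dimension of U / W, without forming the quotient. *)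
Definition reldim U W (r : nat) := exists (I : finType) (v : I -> V),
  [/\ #|I| = r, forall i, U (v i),
      forall x, U x -> exists c : I -> k, W (x - \sum_i c i *: v i)
    & forall c : I -> k, W (\sum_i c i *: v i) -> forall i, c i = 0].

Lemma reldim_refl U : subspace U -> reldim U U 0.
Proof.
move=> sU; exists void, (fun _ => 0); split=> [|[]|x Ux|c _ []].
  exact: card_void.
by exists (fun _ => 0); rewrite big1 ?subr0 // => -[].
Qed.

Lemma reldim_trans U W Z r s : subspace W -> (Z `<=` W)%classic ->
  (W `<=` U)%classic -> reldim W Z r -> reldim U W s -> reldim U Z (r + s).
Proof.
move=> sW ZW WU [I [w [<- wW wspan wfree]]] [J [u [<- uU uspan ufree]]].
pose v (i : I + J) := match i with inl i => w i | inr j => u j end.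
have sumE (c : I + J -> k) : \sum_i c i *: v i =
    \sum_i c (inl i) *: w i + \sum_j c (inr j) *: u j by exact: big_sumType.
exists (I + J)%type, v; split; first by rewrite card_sum.
- by case=> [i|j] /=; [apply/WU/wW|apply: uU].
- move=> x /uspan[d /wspan[c Zx]].
  exists (fun i => match i with inl i => c i | inr j => d j end).
  by rewrite sumE /= opprD [X in x + X]addrC addrA.
- move=> c; rewrite sumE => Zs.
  have Ww : W (\sum_i c (inl i) *: w i).
    by apply: subspace_sum => // i _; apply: subspaceZ.
  have d0 : forall j, c (inr j) = 0.
    apply: (ufree (fun j => c (inr j))).
    by rewrite -[X in W X](addKr (\sum_i c (inl i) *: w i)) addrC;
       apply: subspaceB => //; apply: ZW.
  have c0 : forall i, c (inl i) = 0.
    apply: (wfree (fun i => c (inl i))); move: Zs.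
    by rewrite [X in _ + X]big1 ?addr0 // => j _; rewrite d0 scale0r.
  by case.
Qed.

End RelativeDimension.

(** * Spaces of polynomials and the degrees of their elements *)

Section LeadingDegrees.
Variable k : fieldType.
Implicit Types (U W : set {poly k}).

Definition degs U (b : nat) : bool := `[< exists2 p, U p & size p = b.+1 >].

Lemma degsP U b : reflect (exists2 p, U p & size p = b.+1) (degs U b).
Proof. exact: asboolP. Qed.

(** A space of polynomials of bounded degree has one basis vector for each
    degree that its elements reach: subtracting elements of U and of a chosen
    family lowers the degree of an element of W until it is 0. *)
Lemma reldim_degs U W N : subspace U -> subspace W -> (U `<=` W)%classic ->
  (forall p, W p -> (size p <= N)%N) ->
  reldim W U #|[pred b : 'I_N | degs W b && ~~ degs U b]|.
Proof.
move=> sU sW UW WN; set A := [pred b : 'I_N | _].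
have /choice[w wP] : forall b, exists p : {poly k}, degs W b -> W p /\ size p = b.+1.
  move=> b; case: (degsP W b) => [[p Wp sp]|_]; last by exists 0.
  by exists p.
exists {b : 'I_N | b \in A}, (fun b : {b : 'I_N | b \in A} => w (val b)); split; first by rewrite card_sig.
- by case=> b /= /andP[/wP[]].
- have main n (p : {poly k}) : (size p <= n)%N -> W p ->
      exists c : 'I_N -> k, U (p - \sum_(b | A b) c b *: w b).
    elim: n p => [|n IHn] p.
      rewrite leqn0 size_poly_eq0 => /eqP -> _; exists (fun _ => 0).
      by rewrite big1 ?subr0; [case: sU|move=> b _; rewrite scale0r].
    move=> sp Wp; case: (leqP (size p) n) => [/IHn/(_ Wp)//|np].
    have {np}sp : size p = n.+1 by apply/eqP; rewrite eqn_leq sp np.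
    (* elements of the same degree cancel their leading terms *)
    have red (q : {poly k}) : size q = n.+1 -> exists a,
        (size (p - a *: q)%R <= n)%N.
      move=> sq; exists (p`_n / q`_n); apply/leq_sizeP => j.
      rewrite leq_eqVlt coefB coefZ => /orP[/eqP <-|lt].
        rewrite divfK ?subrr //; have : lead_coef q != 0.
          by rewrite lead_coef_eq0 -size_poly_eq0 sq.
        by rewrite /lead_coef sq.
      by rewrite [p`_j]nth_default ?sp // [q`_j]nth_default ?sq // mulr0 subrr.
    have nN : (n < N)%N by rewrite -sp; apply: WN.
    case: (boolP (degs U n)) => [/degsP[q Uq sq]|nU].
      have [a sa] := red q sq.
      have [|c cU] := IHn _ sa; first by apply: subspaceB => //; apply: subspaceZ => //; apply: UW.
      exists c; rewrite -[p in X in U X](subrK (a *: q)) addrAC.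
      by apply: subspaceD => //; apply: subspaceZ.
    have Wn : degs W n by apply/degsP; exists p.
    have [Wq sq] := wP _ Wn; have [a sa] := red _ sq.
    have [|c cU] := IHn _ sa; first by apply: subspaceB => //; apply: subspaceZ.
    pose n' := Ordinal nN; exists (fun b => c b + (b == n')%:R * a).
    suff -> : \sum_(b | A b) (c b + (b == n')%:R * a) *: w b =
        \sum_(b | A b) c b *: w b + a *: w n.
      by rewrite [X in _ - X]addrC opprD addrA.
    under eq_bigr do rewrite scalerDl; rewrite big_split /=; congr (_ + _).
    rewrite (bigD1 n') /=; last by rewrite Wn nU.
    rewrite big1 => [|b /andP[_ /negPf ->]]; last by rewrite mul0r scale0r.
    by rewrite eqxx mul1r addr0.
  move=> p Wp; have [c cU] := main _ p (leqnn _) Wp.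
  exists (fun b => c (val b)).
  by rewrite (big_sub (mem A) (fun b => c b *: w b)) in cU.
- move=> c Uc.
  pose c' (b : 'I_N) := if insub b is Some b' then c b' else 0.
  have c'E (b : {b : 'I_N | b \in A}) : c b = c' (val b) by rewrite /c' valK.
  suff c0 : forall b, A b -> c' b = 0 by move=> b; rewrite c'E c0 //; case: b.
  apply: contrapT => /existsNP[b0 /not_implyP[Ab0 /eqP cb0]].
  (* the largest b with c' b <> 0 would be a degree reached in U *)
  have [b /andP[Ab cb] bmax] := @arg_maxnP _ b0 (fun b => A b && (c' b != 0)) val
     (introT andP (conj Ab0 cb0)).
  have [Wb sb] := wP _ (andP Ab).1.
  have /andP[_ /negP[]] := Ab; apply/degsP.
  exists (\sum_i c i *: w (val i)) => //.
  have -> : \sum_i c i *: w (val i) = \sum_(i | A i) c' i *: w i.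
    rewrite (big_sub (mem A) (fun i => c' i *: w i)).
    by apply: eq_bigr => i _; rewrite c'E.
  rewrite (bigD1 b) //= size_polyDl size_scale //.
  rewrite sb ltnS; apply: (leq_trans (size_sum _ _ _)); apply/bigmax_leqP => i /andP[Ai ib].
  have [->|ci] := eqVneq (c' i) 0; first by rewrite scale0r size_poly0.
  rewrite size_scale // (wP _ (andP Ai).1).2.
  by rewrite ltn_neqAle (inj_eq val_inj) ib; apply: bmax; apply/andP.
Qed.

End LeadingDegrees.

(** * Graded ideals of a cofinite subring of k[x, y] *)

Section GradedIdeals.
Variables (k : fieldType) (A : nat -> set {poly k}) (n1 : nat).
Implicit Type U : nat -> set {poly k}.

(** A n stands for a space of forms of degree n in x and y, dehomogenized at
    x = 1; in k[x, y] the sum of these spaces has finite codimension. *)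
Record cofinite_part : Prop := CofinitePart {
  cofinite_subspace : forall n, subspace (A n) ;
  cofinite_size : forall n p, A n p -> (size p <= n.+1)%N ;
  cofinite_full : forall n (p : {poly k}), (n1 <= n)%N -> (size p <= n.+1)%N -> A n p }.

Record graded_ideal U : Prop := GradedIdeal {
  gideal_subspace : forall n, subspace (U n) ;
  gideal_sub : forall n, (U n `<=` A n)%classic ;
  gideal_mul : forall m n a p, A m a -> U n p -> U (m + n)%N (a * p) }.

Hypothesis Agr : cofinite_part.

Definition quotient_dim U n := #|[pred b : 'I_n.+1 | degs (A n) b && ~~ degs (U n) b]|.

Lemma degs_full n b : (n1 <= n)%N -> (b <= n)%N -> degs (A n) b.
Proof.
move=> n1n bn; apply/degsP; exists 'X^b; last by rewrite size_polyXn.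
by apply: (cofinite_full Agr); rewrite ?size_polyXn.
Qed.

Section Ideal.
Variable U : nat -> set {poly k}.
Hypothesis idU : graded_ideal U.

Lemma reldim_quotient_dim n : reldim (A n) (U n) (quotient_dim U n).
Proof.
apply: reldim_degs; first exact: gideal_subspace idU n.
- exact: cofinite_subspace Agr n.
- exact: gideal_sub idU n.
- exact: (cofinite_size Agr (n := n)).
Qed.

Lemma gideal_size n p : U n p -> (size p <= n.+1)%N.
Proof. by move/(gideal_sub idU)/(cofinite_size Agr). Qed.

Lemma gideal_mulX m n b p : (n1 + m <= n)%N -> (b + m <= n)%N -> U m p ->
  U n ('X^b * p).
Proof.
move=> n1mn bmn Up; have mn : (m <= n)%N by lia.
rewrite -(subnK mn); apply: (gideal_mul idU) => //.
by apply: (cofinite_full Agr); rewrite ?size_polyXn; lia.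
Qed.

Lemma degs_mulX m n b e : (n1 + m <= n)%N -> (b + m <= n)%N -> degs (U m) e ->
  degs (U n) (b + e).
Proof.
move=> n1mn bmn /degsP[p Up sp]; apply/degsP; exists ('X^b * p).
  exact: gideal_mulX Up.
by rewrite mulrC size_mulXn -?size_poly_eq0 sp // addnS.
Qed.

Lemma quotient_dim_zero n : (forall p, U n p -> p = 0) -> (n1 <= n)%N -> quotient_dim U n = n.+1.
Proof.
move=> U0 n1n; rewrite -[RHS]card_ord; apply: eq_card => b; rewrite !inE.
rewrite degs_full ?leq_ord //=; apply/negP => /degsP[p /U0 ->].
by rewrite size_poly0.
Qed.

(** The degrees e reached in U n give all the degrees e, ..., e + c in
    U (c + n), since A c contains 'X^b for b <= c.  Taking e maximal, a degree
    b missing in U (c + n) is missing in U n if b < e, and otherwise exceeds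
    c + e, so that b - c is missing in U n. *)
Lemma quotient_dim_le n c p : (n1 <= n)%N -> (n1 <= c)%N -> U n p -> p != 0 ->
  (quotient_dim U (c + n) <= quotient_dim U n)%N.
Proof.
move=> n1n n1c Up p0.
have ex : exists e, degs (U n) e.
  by exists (size p).-1; apply/degsP; exists p; rewrite ?prednK ?size_poly_gt0.
have bd e : degs (U n) e -> (e <= n)%N.
  by move=> /degsP[q /gideal_size sq eq]; rewrite -ltnS -eq.
case: (ex_maxnP ex bd) => e Ee emax.
(* [f] injects the degrees missing at c + n into those missing at n *)
pose f (b : 'I_(c + n).+1) : 'I_n.+1 := inord (if (b < e)%N then b : nat else (b - c)%N).
have Enot (b : 'I_(c + n).+1) : ~~ degs (U (c + n)%N) b -> (b < e)%N || (c + e < b)%N.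
  apply: contraR; rewrite negb_or -!leqNgt => /andP[eb bce].
  by rewrite -(subnK eb); apply: (degs_mulX _ _ Ee); lia.
have fE (b : 'I_(c + n).+1) : (f b : nat) = if (b < e)%N then b : nat else (b - c)%N.
  rewrite inordK //; have := bd _ Ee; have := ltn_ord b; case: ifP; lia.
pose B := [pred b : 'I_(c + n).+1 | degs (A (c + n)%N) b && ~~ degs (U (c + n)%N) b].
rewrite -[X in (X <= _)%N]/#|B| -(@card_in_imset _ _ f B) => [|x y].
  apply: subset_leq_card; apply/fintype.subsetP => b' /imsetP[b].
  rewrite !inE => /andP[_ nb] ->; rewrite degs_full ?leq_ord //= fE.
  case: ltnP => be.
    by apply: contra nb => Eb; rewrite -[b : nat]add0n; apply: (degs_mulX _ _ Eb); lia.
  apply/negP => /emax; have := Enot _ nb; lia.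
rewrite !inE => /andP[_ /Enot xe] /andP[_ /Enot ye] /(congr1 val).
rewrite /= !fE => H; apply: val_inj => /=.
by move: H; case: ifP; case: ifP; lia.
Qed.

(** A sequence of natural numbers that does not increase under any large
    shift is eventually equal to its minimum. *)
Lemma quotient_dim_eventually : (forall n p, U n p -> p = 0) \/
  exists v n0, forall n, (n0 <= n)%N -> quotient_dim U n = v.
Proof.
case: (pselect (forall n p, U n p -> p = 0)) => [|/existsNP[m]]; first by left.
move=> /existsNP[p /not_implyP[Up /eqP p0]]; right.
pose N0 := (n1 + m)%N.
have step n c : (N0 <= n)%N -> (n1 <= c)%N -> (quotient_dim U (c + n) <= quotient_dim U n)%N.
  move=> N0n n1c; apply: (@quotient_dim_le n c p) => //; first by rewrite /N0 in N0n; lia.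
  by rewrite -[p]mul1r -(expr0 'X); apply: (gideal_mulX _ _ Up); rewrite /N0 in N0n; lia.
have ex : exists v, `[< exists2 n, (N0 <= n)%N & quotient_dim U n = v >].
  by exists (quotient_dim U N0); apply/asboolP; exists N0.
case: (ex_minnP ex) => v /asboolP[n N0n vn] vmin.
exists v, (n1 + n)%N => n' le; apply/eqP; rewrite eqn_leq; apply/andP; split.
  by rewrite -vn -(@subnK n n') ?step //; lia.
by apply: vmin; apply/asboolP; exists n' => //; lia.
Qed.

End Ideal.

End GradedIdeals.

(** Projective Nullstellensatz on the line.  The union of the U n is an ideal
    of k[y].  If it is proper, its generator has a root.  Otherwise U contains
    a power of x; if some element of U m' moreover does not vanish at infinity,
    that is, involves y^m', then the multiples of x^m and of that
    element reach all degrees, so that the quotient is finite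
    dimensional. *)
Lemma gideal_common_zero (k : closedFieldType) (A U : nat -> set {poly k}) n1 :
  cofinite_part A n1 -> graded_ideal A U ->
  (forall n0, exists2 n, (n0 <= n)%N & quotient_dim A U n <> 0%N) ->
  (exists a, forall n p, U n p -> root p a) \/
  (forall n p, U n p -> (size p <= n)%N).
Proof.
move=> Agr idU dimU.
have mulX := gideal_mulX Agr idU; have subU := gideal_subspace idU.
case: (pselect (forall n p, U n p -> (size p <= n)%N)) => [|/existsNP[m']]; first by right.
move=> /existsNP[u /not_implyP[Uu /negP]]; rewrite -ltnNge => su; left.
have {}su : size u = m'.+1 by apply/eqP; rewrite eqn_leq su (gideal_size Agr idU Uu).
pose W (s : nat) := `[< exists p n, [/\ U n p, p != 0 & size p = s] >].
have ex : exists s, W s.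
  exists (size u); apply/asboolP; exists u, m'; split=> //.
  by rewrite -size_poly_eq0 su.
case: (ex_minnP ex) => s /asboolP[g [m [Ug g0 sg]]] smin.
have [s1|s1] := leqP s 1.
  exfalso.
  have [c c0 gE] : exists2 c : k, c != 0 & g = c%:P.
    rewrite -sg in s1; exists g`_0; last exact: size1_polyC.
    by rewrite -polyC_eq0 -size1_polyC.
  have U1 : U m 1.
    have -> : 1 = c^-1 *: g by rewrite gE -mul_polyC -polyCM mulVf.
    by apply: subspaceZ.
  (* degrees up to n - m come from 1 in U m, the others from u in U m' *)
  have [n le] := dimU (n1 + m + m')%N; apply; apply: eq_card0 => b; rewrite !inE.
  apply/negP => /andP[_ /negP[]]; have bn := leq_ord b.
  have [bm|bm] := leqP b (n - m); apply/degsP.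
    exists 'X^b; last by rewrite size_polyXn.
    by rewrite -['X^b]mulr1; apply: (mulX _ _ _ _ _ _ U1); lia.
  exists ('X^(b - m') * u); last first.
    by rewrite mulrC size_mulXn -?size_poly_eq0 su // addnS subnK //; lia.
  by apply: (mulX _ _ _ _ _ _ Uu); lia.
have /closed_rootP[a ga] : size g != 1 by rewrite sg; lia.
exists a => n p Up.
suff dv : g %| p by rewrite -dvdp_XsubCl (dvdp_trans _ dv) ?dvdp_XsubCl.
apply/negPn/negP => ndv.
have : (size (p %% g)%R < s)%N by rewrite -sg ltn_modp.
rewrite ltnNge => /negP; apply; apply: smin; apply/asboolP.
(* both terms of the remainder have to be brought to a common degree N *)
pose q : {poly k} := p %/ g; pose N := (n1 + m + n + size q)%N.
exists (p %% g), N; split=> //.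
have -> : p %% g = 'X^0 * p - q * g by rewrite expr0 mul1r {2}(divp_eq p g) addrC addKr.
apply: subspaceB => //.
  by apply: (mulX _ _ _ _ _ _ Up); rewrite /N; lia.
have -> : N = (N - m + m)%N by rewrite /N; lia.
by apply: (gideal_mul idU) => //; apply: (cofinite_full Agr); rewrite /N; move: (size q) => z; clear; lia.
Qed.

(** * The exponents that an operator of negative degree must kill *)

Section Exceptional.
Variable Gamma : numsemigroup.
Implicit Types v L c : nat.

Definition exceptional v L : seq nat :=
  [seq j <- iota 0 L | (j \in Gamma) && ~~ ((v <= j)%N && ((j - v)%N \in Gamma))].

(** The exponents below L that are not exceptional are the v + i with
    i < L - v and both i and v + i in Gamma.  There are at most as many as
    elements of Gamma below L - v, with equality if v is in Gamma, while
    Gamma has exactly v elements in [L - v, L) as these are above c. *)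
Lemma size_exceptional v L c : (forall n, (c <= n)%N -> n \in Gamma) -> (c + v <= L)%N ->
  (v <= size (exceptional v L))%N /\ (v \in Gamma -> size (exceptional v L) = v).
Proof.
move=> Gc cvL; have vL : (v <= L)%N by lia.
pose cnt m := count (fun j => j \in Gamma) (iota 0 m).
have cntL : cnt L = (cnt (L - v) + v)%N.
  rewrite /cnt -[L in LHS](subnK vL) iotaD count_cat add0n; congr (_ + _)%N.
  rewrite -[RHS](size_iota (L - v)); apply/eqP; rewrite -all_count; apply/allP => j.
  by rewrite mem_iota => /andP[jl _]; apply: Gc; lia.
pose good j := (j \in Gamma) && ((v <= j)%N && ((j - v)%N \in Gamma)).
have split_cnt : cnt L = (size (exceptional v L) + count good (iota 0 L))%N.
  rewrite /cnt size_filter -count_predUI -[LHS]addn0; congr (_ + _)%N.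
    apply: eq_count => j /=; rewrite /good.
    by case: (j \in Gamma) => //=; case: (_ && _).
  symmetry; apply/eqP; rewrite -leqn0 leqNgt -has_count; apply/hasPn => j _ /=.
  by rewrite /good; case: (j \in Gamma); case: ((v <= j)%N && _).
have good_cnt : count good (iota 0 L) =
    count (fun i => ((v + i)%N \in Gamma) && (i \in Gamma)) (iota 0 (L - v)).
  rewrite -[L in LHS](subnKC vL) iotaD count_cat add0n -{2}[v]addn0 iotaDl count_map.
  rewrite -[RHS]add0n; congr (_ + _)%N; last first.
    by apply: eq_count => i /=; rewrite /good leq_addr addKn.
  apply/eqP; rewrite -leqn0 leqNgt -has_count; apply/hasPn => j.
  by rewrite mem_iota add0n => /andP[_ jv]; rewrite /good leqNgt jv !(andbF, andFb).
have le : (count (fun i => ((v + i)%N \in Gamma) && (i \in Gamma)) (iota 0 (L - v)) <= cnt (L - v))%N.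
  by apply: sub_count => i /= /andP[].
split=> [|vG]; first by move: cntL split_cnt le; rewrite good_cnt; lia.
have : count good (iota 0 L) = cnt (L - v)%N.
  rewrite good_cnt; apply: eq_count => i /=; case: (boolP (i \in Gamma)) => iG.
    by rewrite nsgD.
  by rewrite andbF.
by move: cntL split_cnt; lia.
Qed.

End Exceptional.

(** * Operators on a monomial curve and their symbols *)

Lemma coefM_top (R : nzRingType) (p q : {poly R}) m n :
  (size p <= m.+1)%N -> (size q <= n.+1)%N -> (p * q)`_(m + n) = p`_m * q`_n.
Proof.
move=> sp sq; rewrite coefM (bigD1 (inord m)) //= inordK ?ltnS ?leq_addr // addKn.
rewrite big1 ?addr0 // => i im; have [lt|gt|e] := ltngtP i m.
- rewrite [q`_ _]nth_default ?mulr0 //; apply: (leq_trans sq).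
  by have := leq_ord i; lia.
- by rewrite nth_default ?mul0r // (leq_trans sp).
- by case/eqP: im; apply: val_inj; rewrite /= e inordK // ltnS leq_addr.
Qed.

Section Operators.
Variables (k : numFieldType) (Gamma : numsemigroup).
Local Notation D := (diff_curve k Gamma).
Local Notation B := (bernstein_filtration k Gamma).
Implicit Types (P Q : D) (w v : int) (p q n m b : nat) (f g : {poly k}).

Lemma acts_by_curve (P : diffT k) w f : acts_by P w f ->
  (forall g : laurent k, curve Gamma g -> curve Gamma (P g)) <->
  (forall j, j \in Gamma -> f.[j%:R] != 0 -> exists2 i, i \in Gamma & j%:Z + w = i%:Z).
Proof.
move=> Pf; split=> [cP j jG fj|H g /curveP cg].
  have /curveP/(_ (j%:Z + w)) := cP _ (@curveU k _ _ jG).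
  by rewrite Pf mcoeffZ mcoeffUU mulr1; apply.
apply/curveP => i; rewrite {1}(laurentE g) /linext linear_sum raddf_sum /= => nz.
have [j jg] : exists2 j, j \in msupp g & (P (g@_j *: << j >>))@_i != 0.
  apply: contrapT => nj; move/eqP: nz; apply; rewrite big_seq big1 // => j jg.
  by apply: contrapT => /eqP nj'; apply: nj; exists j.
rewrite linearZ /= Pf !mcoeffZ mcoeffU => nz'.
have [n nG jn] : exists2 n, n \in Gamma & j = n%:Z by apply: cg; rewrite mcoeff_neq0.
have [e|ne] := eqVneq (j + w) i; last by rewrite (negPf ne) !mulr0 eqxx in nz'.
rewrite -e jn; apply: H => //; apply: contraNneq nz' => f0.
by rewrite jn -[n%:~R]/(n%:R) f0 mul0r mulr0.
Qed.

Lemma acts_by_exists w f : exists P : diffT k, acts_by P w f.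
Proof.
have [c ->] := ffact_basis (leqnn (size f)).
exists (\sum_m c m *: (Mul << w + m%:Z >> * Der k ^+ m)) => j.
rewrite diffTE_sum horner_sum scaler_suml; apply: eq_bigr => m _.
rewrite diffTZ MulDerU linextU scalerA hornerZ; congr (_ *: << _ >>).
by rewrite addrACA subrr addr0 addrC.
Qed.

(** The polynomial f vanishes at the exceptional exponents, of which there
    are at least v. *)
Lemma order_ge_neg_degree P (v : nat) f : acts_by P (- v%:Z) f -> f != 0 -> (v < size f)%N.
Proof.
move=> Pf f0; have [c Gc] := nsg_large Gamma.
have [vs _] := size_exceptional Gc (leqnn (c + v)).
apply: (leq_ltn_trans vs); rewrite -(size_map (fun j => j%:R : k)).
apply: max_poly_roots => //.
  apply/allP => x /mapP[j]; rewrite mem_filter => /andP[/andP[jG njv] _] ->{x}.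
  apply/rootP/eqP; apply: contraNT njv => fj.
  have [i iG e] := ((acts_by_curve Pf).1 (@diff_curveP k Gamma P)) j jG fj.
  have -> : j = (i + v)%N by lia.
  by rewrite leq_addl addnK.
rewrite map_inj_uniq ?filter_uniq ?iota_uniq // => i j /eqP.
by rewrite eqr_nat => /eqP.
Qed.

(** P is a sum of homogeneous operators; this describes the one of degree w
    without singling it out. *)
Definition expands (P : diffT k) w f := forall j, (P << j >>)@_(j + w) = f.[j%:~R].

Lemma acts_by_expands (P : diffT k) w f v : acts_by P w f ->
  expands P v (if v == w then f else 0).
Proof.
move=> Pf j; rewrite Pf mcoeffZ mcoeffU (inj_eq (addrI j)) eq_sym.
by case: eqP; rewrite ?mulr1 // mulr0 horner0.
Qed.

(** A polynomial over a field of characteristic 0 is determined by its values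
    at the integers. *)
Lemma expands_inj (P : diffT k) w f g : expands P w f -> expands P w g -> f = g.
Proof.
move=> Pf Pg; apply/eqP; rewrite -subr_eq0; apply/negPn/negP => fg0.
have := @max_poly_roots _ (f - g) [seq j%:R | j <- iota 0 (size (f - g))] fg0.
rewrite size_map size_iota ltnn => H; suff : false by []; apply: H.
  apply/allP => x /mapP[j _ ->{x}]; apply/rootP.
  by rewrite hornerD hornerN -[j%:R]/(j%:~R) -Pf -Pg subrr.
by rewrite map_inj_uniq ?iota_uniq // => i j /eqP; rewrite eqr_nat => /eqP.
Qed.

Definition component (P : diffT k) w : {poly k} :=
  xget 0 [set f | expands P w f]%classic.

Lemma componentE (P : diffT k) w f : expands P w f -> component P w = f.
Proof.
move=> Pf; rewrite /component; case: xgetP => [g _ Pg|/(_ f)//].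
exact: expands_inj Pg Pf.
Qed.

Definition weight_le (m : int) (P : diffT k) := forall w,
  exists2 f, expands P w f & forall p, f`_p != 0 -> (2 * p)%:Z + w <= m.

Lemma weight_leD (m : int) (P Q : diffT k) : weight_le m P -> weight_le m Q -> weight_le m (P + Q).
Proof.
move=> mP mQ w; have [f Pf fm] := mP w; have [g Qg gm] := mQ w.
exists (f + g) => [j|p]; first by rewrite diffTD mcoeffD Pf Qg hornerD.
rewrite coefD; have [/eqP f0|/fm//] := boolP (f`_p == 0).
by rewrite f0 add0r; apply: gm.
Qed.

Lemma acts_by_weight_le (m : int) (P : diffT k) w p f : acts_by P w f -> (size f <= p.+1)%N ->
  (2 * p)%:Z + w <= m -> weight_le m P.
Proof.
move=> Pf sf pw v; exists (if v == w then f else 0); first exact: acts_by_expands.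
move=> q; case: (v =P w) => [->|]; last by rewrite coef0 eqxx.
have [le|lt] := leqP q p; first by lia.
by rewrite nth_default ?eqxx // (leq_trans sf).
Qed.

Lemma bernstein_weight_le (m : int) (P : D) : bernstein m P -> weight_le m P.
Proof.
case=> s -> sm; elim: s sm => [|Q s IHs] sm.
  rewrite big_nil => w; exists 0 => [j|p]; last by rewrite coef0 eqxx.
  by rewrite horner0 -[LHS]/((0 : laurent k)@_(j + w)) mcoeff0.
rewrite big_cons; apply: weight_leD.
  have [p [w [pw /homog_curveP[f Qf sf]]]] := sm Q (mem_head _ _).
  exact: acts_by_weight_le Qf sf pw.
by apply: IHs => R sR; apply: sm; rewrite inE sR orbT.
Qed.

Lemma componentP (m : int) (P : D) w : bernstein m P -> expands P w (component P w).
Proof. by move=> /bernstein_weight_le/(_ w)[f Pf _]; rewrite (componentE Pf). Qed.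

Lemma component_weight (m : int) (P : D) w p : bernstein m P -> (component P w)`_p != 0 ->
  (2 * p)%:Z + w <= m.
Proof. by move=> /bernstein_weight_le/(_ w)[f Pf fm]; rewrite (componentE Pf); apply: fm. Qed.

(** The coefficient of y^b is that of theta^b in degree w = n - 2 b, which is
    the coefficient of x^(n-b) y^b in the principal symbol, because t^w theta^b
    has the symbol x^(w+b) y^b. *)
Definition sigma (n : nat) (P : D) : {poly k} :=
  \poly_(b < n.+1) (component P (n%:Z - (2 * b)%:Z))`_b.

Lemma size_sigma n P : (size (sigma n P) <= n.+1)%N.
Proof. exact: size_poly. Qed.

Lemma sigmaP n c P Q : B n P -> B n Q -> sigma n (c *: P + Q) = c *: sigma n P + sigma n Q.
Proof.
move=> BP BQ; apply/polyP => b; rewrite coefD coefZ !coef_poly.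
case: ifP => _; last by rewrite mulr0 addr0.
set w := _ - _; have -> : component (c *: P + Q) w = c *: component P w + component Q w.
  apply: componentE => j; rewrite hornerD hornerZ -(componentP w BP) -(componentP w BQ).
  by rewrite -mcoeffZ -mcoeffD.
by rewrite coefD coefZ.
Qed.

Lemma sigma_prev n P : fprev B n P -> sigma n P = 0.
Proof.
move=> prevP; have {prevP} BP : bernstein (n%:Z - 1) P.
  case: n prevP => [->|n]; first exact: bernstein0.
  by have -> : n.+1%:Z - 1 = n%:Z by lia.
apply/polyP => b; rewrite coef_poly coef0; case: ifP => // _.
apply/eqP/negPn/negP => /(component_weight BP); lia.
Qed.

Lemma fprevP n P : bernstein (n%:Z - 1) P -> fprev B n P.
Proof.
case: n => [|n]; first by move/bernstein_lt0; apply.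
by have -> : n.+1%:Z - 1 = n%:Z by lia.
Qed.

(** Only b = p contributes.  The truncation at b <= n in [sigma] loses
    nothing: if p > n then the degree is below - p, so that an operator of
    order at most p is zero. *)
Lemma sigma_homog n p w P f : acts_by P w f -> (size f <= p.+1)%N ->
  n%:Z = (2 * p)%:Z + w -> sigma n P = f`_p *: 'X^p.
Proof.
move=> Pf sf nE; apply/polyP => b; rewrite coef_poly coefZ coefXn.
rewrite (componentE (acts_by_expands _ Pf)).
have -> : (n%:Z - (2 * b)%:Z == w) = (b == p) by lia.
have [->|_] := eqVneq b p; last by rewrite mulr0 coef0 if_same.
rewrite mulr1; case: ltnP => // np; apply/esym/eqP/negPn/negP => fp.
have [wv f0] : w = - (p - n + p)%N%:Z /\ f != 0.
  by split; [lia|apply: contraNneq fp => ->; rewrite coef0].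
rewrite wv in Pf; have := order_ge_neg_degree Pf f0; lia.
Qed.

(** By additivity P and Q can be taken homogeneous.  If one of them lies in
    the previous step of the filtration both sides vanish; otherwise the
    leading coefficients of the polynomials multiply, as the shift in
    [acts_by_mul] does not change them. *)
Lemma sigmaM m n P Q : B m P -> B n Q -> sigma (m + n) (P * Q) = sigma m P * sigma n Q.
Proof.
have sum0 (l : nat) (s : seq D) (E : D -> D) : (forall R, R \in s -> B l (E R)) ->
    sigma l (\sum_(R <- s) E R) = \sum_(R <- s) sigma l (E R).
  elim: s => [|R s IHs] sE; first by rewrite !big_nil sigma_prev //; apply: rprev0.
  rewrite !big_cons -[E R in LHS]scale1r sigmaP ?scale1r ?IHs //.
  - by move=> S sS; apply: sE; rewrite inE sS orbT.
  - by apply: sE; rewrite mem_head.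
  - rewrite big_seq; apply: rfil_sum => S sS.
    by apply: sE; rewrite inE sS orbT.
move=> BP BQ; have [s Ps sm] := BP; have [r Qr rn] := BQ.
have sB R : R \in s -> B m R.
  by move=> /sm[p [w [pw hR]]]; apply: bernsteinU pw hR.
have rB R : R \in r -> B n R.
  by move=> /rn[p [w [pw hR]]]; apply: bernsteinU pw hR.
rewrite {1}Ps mulr_suml sum0; last by move=> R /sB BR; apply: rfilM.
rewrite Ps (sum0 m _ id) // mulr_suml big_seq [RHS]big_seq; apply: eq_bigr => P' sP'.
rewrite {1}Qr mulr_sumr sum0; last by move=> R /rB BR; apply: rfilM => //; apply: sB.
rewrite Qr (sum0 n _ id) // mulr_sumr big_seq [RHS]big_seq; apply: eq_bigr => Q' rQ'.
have BP' := sB _ sP'; have BQ' := rB _ rQ'.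
have [p [w [pw /homog_curveP[f Pf sf]]]] := sm _ sP'.
have [q [v [qv /homog_curveP[g Qg sg]]]] := rn _ rQ'.
have [pm|pm] := eqVneq m%:Z ((2 * p)%:Z + w); last first.
  have prevP : fprev B m P'.
    by apply/fprevP/(@bernsteinU _ _ _ p w); [lia|apply/homog_curveP; exists f].
  by rewrite (sigma_prev prevP) mul0r sigma_prev //; apply: rprevMr.
have [qn|qn] := eqVneq n%:Z ((2 * q)%:Z + v); last first.
  have prevQ : fprev B n Q'.
    by apply/fprevP/(@bernsteinU _ _ _ q v); [lia|apply/homog_curveP; exists g].
  by rewrite (sigma_prev prevQ) mulr0 sigma_prev //; apply: rprevMl.
rewrite (sigma_homog Pf sf pm) (sigma_homog Qg sg qn) -scalerAl -scalerAr scalerA -exprD.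
have sf' : (size (f \Po ('X + (v%:~R)%:P)) <= p.+1)%N by rewrite size_comp_poly2 ?size_XaddC.
rewrite (@sigma_homog _ (p + q) (w + v) (P' * Q') _ (acts_by_mul Pf Qg)); last 2 first.
- apply: (leq_trans (size_polyMleq _ _)).
  by have := leq_add sf' sg; rewrite addSn addnS; case: (_ + _)%N.
- by lia.
rewrite (coefM_top sf' sg); congr (_ * _ *: _).
have := size_shift f v%:~R; have [->|f0] := eqVneq f 0; first by rewrite comp_poly0.
move=> le; apply/eqP; rewrite -subr_eq0 -coefB nth_default //.
by apply: (leq_trans le); have := sf; lia.
Qed.

Lemma sum_applyE (I : Type) (r : seq I) (Pr : pred I) (E : I -> D) h :
  (\sum_(i <- r | Pr i) E i : D) h = \sum_(i <- r | Pr i) E i h.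
Proof. by apply: (big_morph (fun P : D => P h)). Qed.

(** The homogeneous components of P are in D, because they are sums of terms
    of the decomposition of P that puts it in the Bernstein filtration. *)
Lemma homogeneous_components (m : int) P : bernstein m P ->
  exists (ws : seq int) (E : int -> D), P = \sum_(w <- ws) E w /\
    forall w, w \in ws -> acts_by (E w) w (component P w).
Proof.
move=> BP; have [s Ps sm] := BP.
have /choice[wf wfP] : forall Q, exists wf : int * {poly k},
    Q \in s -> acts_by Q wf.1 wf.2.
  move=> Q; case: (boolP (Q \in s)) => [/sm[p [w [_ /homog_curveP[f Qf _]]]]|_].
    by exists (w, f).
  by exists (0, 0).
pose ws := undup [seq (wf Q).1 | Q <- s].
exists ws, (fun w => \sum_(Q <- s | (wf Q).1 == w) Q); split.
  rewrite (exchange_big_dep xpredT) //= Ps big_seq [RHS]big_seq.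
  apply: eq_bigr => Q sQ; rewrite (eq_bigl (pred1 (wf Q).1)) => [|w]; last exact: eq_sym.
  rewrite -big_filter filter_pred1_uniq ?undup_uniq ?mem_undup //; first by rewrite big_seq1.
  by apply/mapP; exists Q.
move=> w _; rewrite (@componentE P w (\sum_(Q <- s | (wf Q).1 == w) (wf Q).2)) => j.
  rewrite sum_applyE horner_sum scaler_suml big_seq_cond [RHS]big_seq_cond.
  by apply: eq_bigr => Q /andP[sQ /eqP <-]; rewrite (wfP _ sQ).
rewrite {1}Ps sum_applyE raddf_sum horner_sum [RHS]big_mkcond /=.
rewrite big_seq [RHS]big_seq; apply: eq_bigr => Q sQ.
rewrite (acts_by_expands w (wfP _ sQ)) eq_sym.
by case: ifP => _ //; rewrite horner0.
Qed.

(** If a component of P had weight exactly n, its leading coefficient would be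
    a coefficient of the symbol. *)
Lemma sigma_ker n P : B n P -> sigma n P = 0 -> fprev B n P.
Proof.
move=> BP sP0; have [ws [E [PE Ew]]] := homogeneous_components BP.
rewrite PE big_seq; apply: rprev_sum => w ww; apply: fprevP.
pose f := component P w; have Ef : acts_by (E w) w f := Ew w ww.
have [f0|f0] := eqVneq f 0.
  have -> : E w = 0; last exact: bernstein0.
  apply/val_inj/diffT_eq/linear_laurent_eq; try exact/is_diffop_linear/diffTP.
  by move=> j; rewrite [LHS]Ef f0 horner0 scale0r.
have sf : size f = (size f).-1.+1 by rewrite prednK // size_poly_gt0.
have top : (2 * (size f).-1)%:Z + w <= n%:Z.
  by apply: (component_weight BP); rewrite -/f -[_`__]/(lead_coef f) lead_coef_eq0.
apply: (@bernsteinU _ _ _ (size f).-1 w); last first.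
  by apply/homog_curveP; exists f; rewrite -?sf.
have [e|] := eqVneq ((2 * (size f).-1)%:Z + w) n%:Z; last by move: top; lia.
have := sigma_homog Ef (eq_leq sf) (esym e).
have : (sigma n P)`_(size f).-1 = f`_(size f).-1.
  rewrite coef_poly; have -> : n%:Z - (2 * (size f).-1)%:Z = w by lia.
  rewrite -/f; case: ltnP => // np.
  have wv : w = - ((size f).-1 - n + (size f).-1)%N%:Z by lia.
  rewrite wv in Ef.
  have := order_ge_neg_degree Ef f0; lia.
rewrite sP0 coef0 => /esym/eqP; rewrite -[_`__]/(lead_coef f) lead_coef_eq0.
by rewrite (negPf f0).
Qed.

(** For y^b in degree n an operator of degree w = n - 2 b and order b is
    needed, that is, a monic polynomial of degree b that vanishes on the j in
    Gamma with j + w outside Gamma.  For w >= c there is no such j.  For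
    w <= - c there are |w| of them, and |w| <= b.  In between they are all
    below c - w, which is at most b once n >= 5 c. *)
Lemma sigma_onto : exists n1, forall n b, (n1 <= n)%N -> (b <= n)%N ->
  exists2 P, B n P & sigma n P = 'X^b.
Proof.
have [c Gc] := nsg_large Gamma; exists (5 * c)%N => n b cn bn.
pose w : int := n%:Z - (2 * b)%:Z.
suff [f [sf fb fG]] : exists f : {poly k}, [/\ (size f <= b.+1)%N, f`_b = 1 &
    forall j, j \in Gamma -> f.[j%:R] != 0 -> exists2 i, i \in Gamma & j%:Z + w = i%:Z].
  have [P Pf] := acts_by_exists w f.
  have Pc : P \in diff_curve_pred Gamma.
    by rewrite unfold_in; apply/asboolP; exact: ((acts_by_curve Pf).2 fG).
  exists (DiffCurve Pc).
    apply: (@bernsteinU _ _ _ b w); first by rewrite /w; lia.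
    by apply/homog_curveP; exists f.
  rewrite (@sigma_homog n b w (DiffCurve Pc) f) //; first by rewrite fb scale1r.
  by rewrite /w; lia.
pose S := if w <= - c%:Z then exceptional Gamma `|w|%N (c + `|w|)%N else iota 0 `|c%:Z - w|%N.
have Sb : w < c%:Z -> (size S <= b)%N.
  rewrite /S => wc; case: ifP => [wl|]; last by rewrite size_iota /w; lia.
  have [_ ->] := size_exceptional Gc (leqnn (c + `|w|)%N); first by rewrite /w; lia.
  by apply: Gc; lia.
have SP j : w < c%:Z -> j \in Gamma -> j \notin S -> exists2 i, i \in Gamma & j%:Z + w = i%:Z.
  rewrite /S => wc jG; case: ifP => wl; last first.
    by rewrite mem_iota => jl; exists (absz (j%:Z + w)); [apply: Gc|]; lia.
  rewrite mem_filter jG mem_iota add0n /= negb_and negbK -leqNgt.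
  case/orP => [/andP[jw jG']|le]; first by exists (j - `|w|)%N => //; lia.
  by exists (j - `|w|)%N; [apply: Gc|]; lia.
have [wc|wc] := leP c%:Z w.
  exists 'X^b; rewrite size_polyXn coefXn eqxx; split=> // j jG _.
  by exists (absz (j%:Z + w)); [apply: Gc|]; lia.
pose g : {poly k} := \prod_(j <- S) ('X - (j%:R)%:P).
have sg : size g = (size S).+1 by rewrite size_prod_XsubC.
have mg : g \is monic by apply: monic_prod_XsubC.
exists (g * 'X^(b - size S)); split.
- by rewrite size_mulXn ?monic_neq0 // sg addnS subnK ?Sb.
- rewrite coefMXn ltnNge leq_subr /= subKn ?Sb //.
  by move: mg; rewrite monicE /lead_coef sg => /eqP.
- move=> j jG nz; apply: SP => //; apply: contraNN nz => jS.
  rewrite hornerM (_ : g.[_] = 0) ?mul0r //; apply/rootP.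
  rewrite /g -(big_map (fun j => j%:R : k) xpredT (fun a => 'X - a%:P)).
  by rewrite root_prod_XsubC; apply/mapP; exists j.
Qed.

End Operators.

(** * The associated graded ring as a subring of k[y][h] *)

Section Kernel.
Variables (R : comNzRingType) (S : idomainType) (f : {rmorphism R -> S}).

Definition kernel : {pred R} := fun x => f x == 0.

Lemma kernelE x : (x \in kernel) = (f x == 0). Proof. by []. Qed.

Fact kernel_idealr : idealr_closed kernel.
Proof.
split; rewrite ?unfold_in ?rmorph0 ?rmorph1 ?oner_eq0 // => a x y.
by rewrite !unfold_in rmorphD rmorphM => /eqP-> /eqP->; rewrite mulr0 addr0.
Qed.

Fact kernel_prime : prime_idealr_closed kernel.
Proof. by move=> x y; rewrite !unfold_in rmorphM mulf_eq0. Qed.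

HB.instance Definition _ := isIdealr.Build R kernel kernel_idealr.
HB.instance Definition _ := isPrimeIdealrClosed.Build R kernel kernel_prime.

End Kernel.

Section RingFiltration.
Variables (D : nzRingType) (F : ring_filtration D).

Lemma rfilN n a : F n a -> F n (- a).
Proof. by move=> Fa; rewrite -sub0r; apply: rfilB => //; apply: rfil0. Qed.

Lemma rfilD n a b : F n a -> F n b -> F n (a + b).
Proof. by move=> Fa Fb; rewrite -[b]opprK; apply/rfilB/rfilN. Qed.

End RingFiltration.

Section SymbolRing.
Variables (k : numFieldType) (Gamma : numsemigroup).
Local Notation D := (diff_curve k Gamma).
Local Notation B := (bernstein_filtration k Gamma).
Local Notation grD := (gr B).
Implicit Types (P Q : D) (z : grD) (p q : rees B).

Lemma sigma0 n : sigma n (0 : D) = 0.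
Proof. by apply: sigma_prev; apply: rprev0. Qed.

Lemma sigmaB n P Q : B n P -> B n Q -> sigma n (P - Q) = sigma n P - sigma n Q.
Proof. by move=> BP BQ; rewrite addrC -[- Q]scaleN1r sigmaP // scaleN1r addrC. Qed.

Lemma sigma_sum n (I : Type) (r : seq I) (Pr : pred I) (E : I -> D) :
  (forall i, Pr i -> B n (E i)) ->
  sigma n (\sum_(i <- r | Pr i) E i) = \sum_(i <- r | Pr i) sigma n (E i).
Proof.
move=> BE; pose K x P := sigma n P = x /\ B n P.
suff [] : K (\sum_(i <- r | Pr i) sigma n (E i)) (\sum_(i <- r | Pr i) E i) by [].
apply: (big_rec2 K); first by split; [apply: sigma0|apply: rfil0].
move=> i x P /BE BEi [<- BP]; split; last exact: rfilD.
by rewrite -[E i]scale1r sigmaP ?scale1r.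
Qed.

Lemma sigma1 : sigma 0 (1 : D) = 1.
Proof.
rewrite (@sigma_homog _ _ 0 0 0 _ 1) ?size_poly1 //.
  by rewrite coef1 scale1r expr0.
by move=> j; rewrite hornerC scale1r addr0.
Qed.

(** The power of h records the degree, so that y^b h^n stands for
    x^(n-b) y^b. *)
Definition phi z : {poly {poly k}} :=
  \poly_(i < size (rees_poly (repr z))) sigma i (rees_poly (repr z))`_i.

Lemma coef_phi z i : (phi z)`_i = sigma i (rees_poly (repr z))`_i.
Proof.
by rewrite coef_poly; case: ltnP => // le; rewrite nth_default // sigma0.
Qed.

Lemma coef_phi_pi p i : (phi (gr_pi p))`_i = sigma i (rees_poly p)`_i.
Proof.
rewrite coef_phi; set q := repr _.
have : q - p \in rees_ideal B by apply/gr_piE; rewrite gr_repr.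
rewrite unfold_in => /asboolP/(_ i) /=; rewrite coefB => /sigma_prev.
by rewrite sigmaB; [move/eqP; rewrite subr_eq0 => /eqP|apply: reesP..].
Qed.

Fact phi_zmod : zmod_morphism phi.
Proof.
move=> x y; rewrite -[x]gr_repr -[y]gr_repr.
have -> : gr_pi (repr x) - gr_pi (repr y) = gr_pi (repr x - repr y).
  by apply: (addIr (gr_pi (repr y))); rewrite -gr_piD !subrK.
apply/polyP => i; rewrite coefB !coef_phi_pi /= coefB.
by apply: sigmaB; apply: reesP.
Qed.

Fact phi_monoid : monoid_morphism phi.
Proof.
split.
  apply/polyP => i; rewrite [LHS]coef_phi_pi /= !coef1.
  by case: i => [|i]; rewrite ?sigma1 ?sigma0.
move=> x y; rewrite -[x]gr_repr -[y]gr_repr -[_ * _]gr_piM.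
apply/polyP => i; rewrite coefM coef_phi_pi /= coefM sigma_sum => [|j _].
  apply: eq_bigr => j _; rewrite !coef_phi_pi -{1}(subnKC (leq_ord j)).
  by apply: sigmaM; apply: reesP.
by rewrite -{1}(subnKC (leq_ord j)); apply: rfilM; apply: reesP.
Qed.

HB.instance Definition _ := GRing.isZmodMorphism.Build grD {poly {poly k}} phi phi_zmod.
HB.instance Definition _ := GRing.isMonoidMorphism.Build grD {poly {poly k}} phi phi_monoid.

Lemma phiB : {morph phi : x y / x - y}. Proof. exact: phi_zmod. Qed.

Lemma phiM : {morph phi : x y / x * y}. Proof. exact: phi_monoid.2. Qed.

Lemma phi1 : phi 1 = 1. Proof. exact: phi_monoid.1. Qed.

Lemma phi_eq0 z : phi z = 0 -> z = 0.
Proof.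
move=> z0; rewrite -[z]gr_repr -[0]gr_repr; apply/gr_piE.
have e0 : repr (0 : grD) \in rees_ideal B.
  rewrite -[X in X \in _]subr0; apply/gr_piE; rewrite gr_repr.
  by apply: (addIr (gr_pi 0)); rewrite -gr_piD !add0r.
apply: rpredB => //; rewrite unfold_in; apply/asboolP => i /=.
apply: sigma_ker; first exact: reesP.
by rewrite -coef_phi z0 coef0.
Qed.

Lemma size_coef_phi z i : (size ((phi z)`_i)%R <= i.+1)%N.
Proof. by rewrite coef_phi; apply: size_sigma. Qed.

Lemma homog_exists n P : B n P -> exists z, phi z = (sigma n P)%:P * 'X^n.
Proof.
move=> BP; have rP : P%:P * 'X^n \in rees_pred B.
  rewrite unfold_in; apply/asboolP => i; rewrite coefCM coefXn.
  by case: eqP => [->|_]; rewrite ?mulr1 // mulr0; apply: rfil0.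
exists (gr_pi (Rees rP)); apply/polyP => i; rewrite coef_phi_pi /= !coefCM !coefXn.
by case: eqP => [->|_]; rewrite ?mulr1 // !mulr0 sigma0.
Qed.

Fact kappa_subproof (c : k) : (c%:A : D)%:P \in rees_pred B.
Proof.
rewrite unfold_in; apply/asboolP => i; rewrite coefC; case: eqP => [->|_]; last exact: rfil0.
apply: (@bernsteinU _ _ _ 0 0) => //; apply/homog_curveP; exists c%:P; last by rewrite size_polyC leq_b1.
by move=> j; rewrite hornerC addr0.
Qed.

(** The structure map k -> gr D. *)
Definition kappa c : grD := gr_pi (Rees (kappa_subproof c)).

Lemma phi_kappa c : phi (kappa c) = c%:P%:P.
Proof.
apply/polyP => i; rewrite coef_phi_pi /= !coefC; case: eqP => [->|_]; last exact: sigma0.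
rewrite (@sigma_homog _ _ 0 0 0 _ c%:P) ?size_polyC ?leq_b1 //.
  by rewrite coefC eqxx expr0 -mul_polyC mulr1.
by move=> j; rewrite hornerC addr0.
Qed.

Definition symbols n : set {poly k} := [set sigma n P | P in B n]%classic.

Lemma symbols_cofinite : exists n1, cofinite_part symbols n1.
Proof.
have [n1 onto] := sigma_onto k Gamma; exists n1.
have sS n : subspace (symbols n).
  split; first by exists 0; [apply: rfil0|apply: sigma0].
  move=> c _ _ [P BP <-] [Q BQ <-]; exists (c *: P + Q); last exact: sigmaP.
  apply: rfilD => //; rewrite -[c *: P]mulr_algl -[n]add0n; apply: rfilM => //.
  by have := reesP (Rees (kappa_subproof c)) 0; rewrite /= coefC.
split=> // [n _ [P _ <-]|n p n1n sp]; first exact: size_sigma.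
rewrite -(coefK p) poly_def; apply: subspace_sum => // i _; apply: subspaceZ => //.
have [|P BP <-] := onto n i n1n; last by exists P.
by rewrite -ltnS; apply: leq_trans sp.
Qed.

Lemma monomial_exists : exists n1, forall n b, (n1 <= n)%N -> (b <= n)%N ->
  exists z, phi z = ('X^b)%:P * 'X^n.
Proof.
have [n1 onto] := sigma_onto k Gamma; exists n1 => n b n1n bn.
by have [P BP <-] := onto n b n1n bn; apply: homog_exists.
Qed.

End SymbolRing.

(** * Prime ideals of the associated graded ring *)

Section Primes.
Variables (k : numFieldType) (Gamma : numsemigroup).
Local Notation D := (diff_curve k Gamma).
Local Notation B := (bernstein_filtration k Gamma).
Local Notation grD := (gr B).
Implicit Types (P Q : D) (z : grD) (p q : rees B).

(** Restriction of forms to the line y = a x. *)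
Definition value_at (a : k) := map_poly (horner_eval a) \o @phi k Gamma.
HB.instance Definition _ a := GRing.RMorphism.on (value_at a).

Lemma coef_value_at a z i : (value_at a z)`_i = ((phi z)`_i).[a].
Proof. by rewrite coef_map. Qed.

(** Restriction of forms to the line x = 0: only y^n h^n survives. *)
Definition value_at_infinity z : {poly k} := \poly_(i < size (phi z)) ((phi z)`_i)`_i.

Lemma coef_value_at_infinity z i : (value_at_infinity z)`_i = ((phi z)`_i)`_i.
Proof.
by rewrite coef_poly; case: ltnP => // le; rewrite [(phi z)`_i]nth_default // coef0.
Qed.

Fact value_at_infinity_zmod : zmod_morphism value_at_infinity.
Proof.
move=> x y; apply/polyP => i.
by rewrite coefB !coef_value_at_infinity phiB !coefB.
Qed.

Fact value_at_infinity_monoid : monoid_morphism value_at_infinity.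
Proof.
split.
  apply/polyP => i; rewrite coef_value_at_infinity phi1 !coef1.
  by case: i => [|i] /=; rewrite ?coef0 // coef1.
move=> x y; apply/polyP => i.
rewrite coefM coef_value_at_infinity phiM coefM coef_sum.
apply: eq_bigr => j _; rewrite !coef_value_at_infinity.
by rewrite -(@coefM_top k) ?size_coef_phi // subnKC // -ltnS.
Qed.

HB.instance Definition _ :=
  GRing.isZmodMorphism.Build grD {poly k} value_at_infinity value_at_infinity_zmod.
HB.instance Definition _ :=
  GRing.isMonoidMorphism.Build grD {poly k} value_at_infinity value_at_infinity_monoid.

Definition constant_term := horner_eval (0 : k) \o horner_eval 0 \o @phi k Gamma.
HB.instance Definition _ := GRing.RMorphism.on constant_term.

Lemma constant_termE z : constant_term z = ((phi z)`_0)`_0.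
Proof. by rewrite /constant_term /= /horner_eval !horner_coef0. Qed.

Definition independent (I : finType) (X : I -> grD) (p : {pred grD}) :=
  forall c : I -> k, \sum_i kappa Gamma (c i) * X i \in p -> forall i, c i = 0.

Lemma kappa0 : kappa Gamma (0 : k) = 0.
Proof. by apply: phi_eq0; rewrite phi_kappa. Qed.

(** If a sum of a^l Y_l is in p, then Y_0 is in q, because a is; when this
    forces Y_0 = 0, the prime p allows dividing the sum by a. *)
Lemma power_sum_prime (p : prime_idealr grD) (q : idealr grD) a T (Y : nat -> grD) :
  {subset p <= q} -> a \in q -> a \notin p ->
  (forall l, (l < T)%N -> Y l \in q -> Y l = 0) ->
  \sum_(l < T) a ^+ l * Y l \in p -> forall l, (l < T)%N -> Y l \in q.
Proof.
move=> pq aq ap; elim: T Y => // T IHT Y Y0.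
rewrite big_ord_recl expr0 mul1r.
under eq_bigr do rewrite exprS -mulrA; rewrite -mulr_sumr => Sp.
have Yq : Y 0%N \in q.
  rewrite -[Y _](addrK (a * \sum_(i < T) a ^+ i * Y (bump 0 i))).
  by apply: rpredB; [apply: pq|rewrite mulrC; apply: idealMr].
move: Sp; rewrite (Y0 0%N) // add0r prime_idealrM (negPf ap) /= => Sp.
case=> [//|l lT]; apply: (IHT (fun l => Y l.+1)) => // l' l'T.
exact: Y0.
Qed.

Lemma independent_powers (p q : prime_idealr grD) a T (I : finType) (X : I -> grD) :
  {subset p <= q} -> a \in q -> a \notin p -> independent X q ->
  independent (fun li : 'I_T * I => a ^+ li.1 * X li.2) p.
Proof.
move=> pq aq ap Xq c Sp.
pose C l i := if insub l is Some l' then c (l', i) else 0.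
have CE (l : 'I_T) i : C l i = c (l, i) by rewrite /C valK.
pose Y l := \sum_i kappa Gamma (C l i) * X i.
have Y0 l : (l < T)%N -> Y l \in q -> Y l = 0.
  by move=> _ /Xq Cl0; rewrite /Y big1 // => i _; rewrite Cl0 kappa0 mul0r.
have Sp' : \sum_(l < T) a ^+ l * Y l \in p.
  suff -> : \sum_(l < T) a ^+ l * Y l = \sum_i kappa Gamma (c i) * (a ^+ i.1 * X i.2) by [].
  under eq_bigr do rewrite mulr_sumr; rewrite pair_bigA /=.
  by apply: eq_bigr => -[l i] _; rewrite CE mulrCA.
case=> l i; rewrite -CE; apply: (Xq (C l)).
exact: (power_sum_prime pq aq ap Y0 Sp').
Qed.

Lemma independent1 (p : idealr grD) : independent (fun _ : 'I_1 => 1) p.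
Proof.
move=> c; rewrite big_ord1 mulr1 => cp i; rewrite ord1.
apply/eqP; apply: contraTT cp => c0; apply/negP => cp.
suff : (1 : grD) \in p by rewrite idealr1.
have -> : 1 = kappa Gamma (c ord0)^-1 * kappa Gamma (c ord0).
  apply/eqP; rewrite -subr_eq0; apply/eqP/phi_eq0.
  by rewrite phiB phiM phi1 !phi_kappa -!polyCM mulVf // subrr.
exact: idealMr.
Qed.

(** The family consists of the monomials a_1^l_1 ... a_n^l_n with all l_i < T,
    where a_i is in p_i but not in p_(i-1).  It is built from the top of the
    chain downwards: one more a_i multiplies the number of elements by T and
    lowers the prime by one step. *)
Lemma chain_independent n (p : 'I_n.+1 -> prime_idealr grD) :
  (forall i j : 'I_n.+1, (i < j)%N ->
     {subset p i <= p j} /\ exists2 a, a \in p j & a \notin p i) ->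
  exists K, forall T, exists (I : finType) (X : I -> grD),
    [/\ #|I| = (T ^ n)%N, forall i, (size (phi (X i)) <= (K * T).+1)%N
      & independent X (p ord0)].
Proof.
move=> chain; suff main j : (j <= n)%N -> exists K, forall T,
    exists (I : finType) (X : I -> grD),
    [/\ #|I| = (T ^ j)%N, forall i, (size (phi (X i)) <= (K * T).+1)%N
      & independent X (p (inord (n - j)))].
  have := main n (leqnn _); rewrite subnn.
  by have -> : inord 0 = ord0 :> 'I_n.+1 by apply: val_inj; rewrite /= inordK.
elim: j => [_|j IHj jn].
  exists 0%N => T; exists 'I_1, (fun _ => 1); split; rewrite ?card_ord //.
    by rewrite phi1 size_poly1.
  exact: independent1.
have [K IHK] := IHj (ltnW jn).
have [|pq [a aq ap]] := chain (inord (n - j.+1)) (inord (n - j)).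
  by rewrite !inordK; lia.
exists (K + size (phi a))%N => T; have [I [X [cI sX Xq]]] := IHK T.
exists ('I_T * I)%type, (fun li : 'I_T * I => a ^+ li.1 * X li.2); split.
- by rewrite card_prod card_ord cI expnS.
- case=> l i /=; rewrite phiM rmorphXn /=.
  apply: (leq_trans (size_polyMleq _ _)).
  have sa : (size (phi a ^+ l) <= (size (phi a) * T).+1)%N.
    apply: (leq_trans (size_poly_exp_leq _ _)); rewrite ltnS.
    by apply: leq_mul; [apply: leq_pred|apply: ltnW].
  have := leq_add sa (sX i); rewrite mulnDl addSn addnS [(K * T + _)%N]addnC.
  by case: (size (phi a ^+ l) + _)%N.
- exact: independent_powers Xq.
Qed.

End Primes.

(** * The filtration by cyclic modules and its dimensions *)

Section ScalarRestriction.
Variables (k : fieldType) (D : algType k).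

(** An alias of M that carries the k-vector space structure of M. *)
Definition kspace (M : lmodType D) : Type := M.

Variable M : lmodType D.

HB.instance Definition _ := GRing.Zmodule.on (kspace M).

Definition kscale (c : k) (x : kspace M) : kspace M := (c%:A : D) *: (x : M).

Fact kscaleA a b x : kscale a (kscale b x) = kscale (a * b) x.
Proof. by rewrite /kscale scalerA mulr_algl scalerA. Qed.
Fact kscale1 : left_id 1 kscale.
Proof. by move=> x; rewrite /kscale !scale1r. Qed.
Fact kscaleDr : right_distributive kscale +%R.
Proof. by move=> a x y; rewrite /kscale scalerDr. Qed.
Fact kscaleDl x : {morph kscale^~ x : a b / a + b}.
Proof. by move=> a b; rewrite /kscale !scalerDl. Qed.

HB.instance Definition _ := GRing.Zmodule_isLmodule.Build k (kspace M)
  kscaleA kscale1 kscaleDr kscaleDl.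

Lemma kscaleE c (x : kspace M) : c *: x = (c%:A : D) *: (x : M). Proof. by []. Qed.

Lemma dim_eq_reldim (U : set M) N :
  reldim (U : set (kspace M)) [set 0]%classic N -> dim_eq U N.
Proof.
case=> I [v [<- Uv span free]]; exists (fun i => v (enum_val i)); split=> //.
  move=> x /span[c /eqP]; rewrite subr_eq0 => /eqP ->.
  exists (fun i => c (enum_val i)).
  by rewrite (big_enum_val (fun i => (c i)%:A *: v i)).
move=> c c0 i; pose d (j : I) := c (enum_rank j).
have : d (enum_val i) = 0; last by rewrite /d enum_valK.
apply: free; rewrite (big_enum_val (fun j => (d j)%:A *: v j)) /=.
by rewrite -[RHS]c0; apply: eq_bigr => j _; rewrite /d enum_valK.
Qed.

End ScalarRestriction.

Section FilteredModule.
Variables (k : numFieldType) (Gamma : numsemigroup).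
Local Notation D := (diff_curve k Gamma).
Local Notation B := (bernstein_filtration k Gamma).
Local Notation grD := (gr B).
Variables (M : lmodType D) (G : mod_filtration B M).
Implicit Types (a b : D) (x y : M) (z : grD) (l m n : nat) (s : seq (nat * M)).

Lemma bernsteinZ n c a : B n a -> B n (c *: a).
Proof.
move=> Ba; rewrite -[c *: a]mulr_algl -[n]add0n; apply: rfilM => //.
by have := reesP (Rees (kappa_subproof Gamma c)) 0; rewrite /= coefC.
Qed.

Lemma prev_sub n x : fprev G n x -> G n x.
Proof. by case: n => [->|n /=]; [apply: mfil0|apply: mfilS]. Qed.

Lemma prev_subspace n : subspace (fprev G n : set (kspace M)).
Proof.
split=> [|c x y]; first exact: mprev0.
case: n => [|n] /=; first by move=> -> ->; rewrite scaler0 addr0.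
by move=> Gx Gy; apply: mfilD => //; apply: mfilZ.
Qed.

Lemma fil_subspace n : subspace (G n : set (kspace M)).
Proof.
split=> [|c x y Gx Gy]; first exact: mfil0.
by apply: mfilD => //; apply: mfilZ.
Qed.

(** M_(n-1) plus the sum of the B^(n-m) x over the (m, x) in s; a generator x
    of degree m > n contributes only a = 0. *)
Fixpoint gen_span s n : set M :=
  if s is (m, x) :: s' then
    [set y | exists a, (if (m <= n)%N then B (n - m)%N a else a = 0) /\
                       gen_span s' n (y - a *: x)]%classic
  else fprev G n.

Lemma gen_span_subspace s n : subspace (gen_span s n : set (kspace M)).
Proof.
elim: s => [|[m x] s IHs]; first exact: prev_subspace.
split=> [|c y y' [a [Ba Ly]] [a' [Ba' Ly']]].
  exists 0; rewrite scale0r subr0; split; last by case: IHs.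
  by case: ifP => // _; apply: rfil0.
exists (c *: a + a'); split.
  case: ifP Ba Ba' => [_ Ba Ba'|_ -> ->]; last by rewrite scaler0 addr0.
  by apply: rfilD => //; apply: bernsteinZ.
have -> : (c *: (y : kspace M) + y' : M) - (c *: a + a') *: x =
    c *: ((y - a *: x : M) : kspace M) + (y' - a' *: x : M).
  by rewrite !kscaleE scalerBr scalerA mulr_algl scalerDl opprD addrACA.
by case: IHs => _; apply.
Qed.

Lemma gen_span_cons s m x n y : gen_span s n y -> gen_span ((m, x) :: s) n y.
Proof.
move=> Ly; exists 0; rewrite scale0r subr0; split=> //.
by case: ifP => // _; apply: rfil0.
Qed.

Lemma prev_gen_span s n y : fprev G n y -> gen_span s n y.
Proof. by elim: s => //= -[m x] s IHs /IHs; apply: gen_span_cons. Qed.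

Definition filtered_seq s := forall mx, mx \in s -> G mx.1 mx.2.

Lemma gen_span_sub s n y : filtered_seq s -> gen_span s n y -> G n y.
Proof.
elim: s y => [|[m x] s IHs] y sG; first exact: prev_sub.
have Gx : G m x := sG (m, x) (mem_head _ _).
case=> a [Ba Ly]; rewrite -[y](subrK (a *: x)); apply: mfilD.
  by apply: IHs Ly => mx smx; apply: sG; rewrite inE smx orbT.
case: ifP Ba => [mn Ba|_ ->]; last by rewrite scale0r; apply: mfil0.
by rewrite -(subnK mn); apply: mfilM.
Qed.

Lemma gen_span_mul s l n b y : B l b -> gen_span s n y -> gen_span s (l + n) (b *: y).
Proof.
move=> Bb; elim: s y => [|[m x] s IHs] y; first exact: mprevMl.
case=> a [Ba Ly]; exists (b * a); split; last by rewrite -scalerA -scalerBr; apply: IHs.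
case: ifP Ba => [mn Ba|_ ->]; last first.
  by rewrite mulr0; case: ifP => // _; apply: rfil0.
by rewrite (leq_trans mn) ?leq_addl // -addnBA //; apply: rfilM.
Qed.

(** The graded ideal U such that gr D / U, shifted by m, is the factor that x
    adds to the submodule generated by s. *)
Definition cyclic_ideal s m x l : set {poly k} :=
  [set sigma l a | a in [set a | B l a /\ gen_span s (l + m) (a *: x)]]%classic.

Lemma cyclic_idealP s m x : graded_ideal (@symbols k Gamma) (cyclic_ideal s m x).
Proof.
split=> [n|n _ [a [Ba _] <-]|l n _ _ [a Ba <-] [b [Bb Lb] <-]].
- split.
    exists 0; last exact: sigma0.
    split; first exact: rfil0.
    by rewrite scale0r; case: (gen_span_subspace s (n + m)).
  move=> c _ _ [a [Ba La] <-] [b [Bb Lb] <-]; exists (c *: a + b); last exact: sigmaP.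
  split; first by apply: rfilD => //; apply: bernsteinZ.
  rewrite scalerDl -[c *: a]mulr_algl -scalerA.
  by case: (gen_span_subspace s (n + m)) => _; apply.
- by exists a.
- exists (a * b); last exact: sigmaM.
  split; first exact: rfilM.
  by rewrite -scalerA -addnA; apply: gen_span_mul.
Qed.

Definition cyclic_dim s m x n : nat :=
  if (m <= n)%N then quotient_dim (@symbols k Gamma) (cyclic_ideal s m x) (n - m) else 0%N.

(** If the symbols of the a_i form a basis of (gr D / U)_(n-m), then the a_i x
    form a basis of the quotient: operators with the same symbol differ by an
    element of B^(n-m-1), which maps x to M_(n-1). *)
Lemma gen_span_reldim n1 s m x n : cofinite_part (@symbols k Gamma) n1 -> G m x ->
  filtered_seq s ->
  reldim (gen_span ((m, x) :: s) n : set (kspace M)) (gen_span s n) (cyclic_dim s m x n).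
Proof.
move=> Agr Gx sG; rewrite /cyclic_dim; case: leqP => mn; last first.
  have -> : gen_span ((m, x) :: s) n = gen_span s n.
    apply/seteqP; split=> y; last exact: gen_span_cons.
    by case=> a; rewrite leqNgt mn /= => -[-> ]; rewrite scale0r subr0.
  exact/reldim_refl/gen_span_subspace.
have [I [v [cI Av span free]]] := reldim_quotient_dim Agr (cyclic_idealP s m x) (n - m).
have {Av}/choice[a aP] : forall i, exists a, B (n - m)%N a /\ sigma (n - m) a = v i.
  by move=> i; have [a Ba <-] := Av i; exists a.
have Baf (c : I -> k) : B (n - m)%N (\sum_i c i *: a i).
  by apply: rfil_sum => i _; apply/bernsteinZ/(aP i).1.
have sig_sum (c : I -> k) : sigma (n - m) (\sum_i c i *: a i) = \sum_i c i *: v i.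
  rewrite sigma_sum => [|i _]; last by apply/bernsteinZ/(aP i).1.
  apply: eq_bigr => i _; rewrite -[c i *: a i]addr0 sigmaP ?sigma0 ?addr0 ?(aP i).2 //.
    exact: (aP i).1.
  exact: rfil0.
have act_sum (c : I -> k) : (\sum_i c i *: a i) *: x = \sum_i c i *: ((a i *: x : M) : kspace M).
  by rewrite scaler_suml; apply: eq_bigr => i _; rewrite kscaleE scalerA mulr_algl.
exists I, (fun i => a i *: x); split=> //.
- move=> i; exists (a i); rewrite mn subrr; split; first exact: (aP i).1.
  by case: (gen_span_subspace s n).
- move=> y [b]; rewrite mn => -[Bb Ly].
  have [c [e [Be Le] sige]] : exists c : I -> k, cyclic_ideal s m x (n - m) (sigma (n - m) b - \sum_i c i *: v i).
    by apply: span; exists b.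
  exists c; rewrite -act_sum; rewrite subnK // in Le.
  pose r := b - \sum_i c i *: a i - e.
  have Br : fprev B (n - m) r.
    apply: sigma_ker; first by do 2?[apply: rfilB].
    by rewrite sigmaB // ?sigmaB // ?sige ?sig_sum ?subrr //; apply: rfilB.
  have -> : y - (\sum_i c i *: a i) *: x = (y - b *: x) + (e *: x + r *: x).
    by rewrite -scalerDl /r [e + _]addrC subrK scalerBl addrA subrK.
  apply: (subspaceD (gen_span_subspace s n)) => //.
  apply: (subspaceD (gen_span_subspace s n)) => //.
  by apply: prev_gen_span; rewrite -{1}(subnK mn); apply: mprevMr.
- move=> c Lc; apply: free; exists (\sum_i c i *: a i); last exact: sig_sum.
  by split=> //; rewrite subnK // act_sum.
Qed.

Fixpoint gr_dim s n : nat :=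
  if s is (m, x) :: s' then (gr_dim s' n + cyclic_dim s' m x n)%N else 0%N.

Lemma gen_span_prev_reldim n1 s n : cofinite_part (@symbols k Gamma) n1 -> filtered_seq s ->
  reldim (gen_span s n : set (kspace M)) (fprev G n) (gr_dim s n).
Proof.
move=> Agr; elim: s => [|[m x] s IHs] sG /=; first exact/reldim_refl/prev_subspace.
have sG' : filtered_seq s by move=> mx smx; apply: sG; rewrite inE smx orbT.
apply: (@reldim_trans _ _ _ (gen_span s n : set (kspace M))).
- exact: gen_span_subspace.
- exact: prev_gen_span.
- exact: gen_span_cons.
- exact: IHs.
- by apply: gen_span_reldim Agr _ _ => //; apply: (sG (m, x)); apply: mem_head.
Qed.

Definition generates s := forall n y, G n y -> gen_span s n y.

Lemma fil_prev_reldim n1 s n : cofinite_part (@symbols k Gamma) n1 -> filtered_seq s ->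
  generates s -> reldim (G n : set (kspace M)) (fprev G n) (gr_dim s n).
Proof.
move=> Agr sG sgen; have := gen_span_prev_reldim n Agr sG.
suff -> : gen_span s n = G n by [].
by apply/seteqP; split=> y; [apply: gen_span_sub|apply: sgen].
Qed.

Lemma fil_reldim n1 s n : cofinite_part (@symbols k Gamma) n1 -> filtered_seq s ->
  generates s ->
  reldim (G n : set (kspace M)) [set 0]%classic (\sum_(l < n.+1) gr_dim s l)%N.
Proof.
move=> Agr sG sgen; have step l := fil_prev_reldim l Agr sG sgen.
elim: n => [|n IHn]; first by rewrite big_ord_recr big_ord0 /=; apply: (step 0%N).
rewrite big_ord_recr /=; apply: (@reldim_trans _ _ _ (G n : set (kspace M))) => //.
- exact: fil_subspace.
- by move=> _ ->; apply: mfil0.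
- exact: mfilS.
Qed.

End FilteredModule.

(** * Generators and annihilators *)

Section Annihilators.
Variables (k : numFieldType) (Gamma : numsemigroup).
Local Notation D := (diff_curve k Gamma).
Local Notation B := (bernstein_filtration k Gamma).
Local Notation grD := (gr B).
Variables (M : lmodType D) (G : mod_filtration B M).
Implicit Types (a b : D) (x y : M) (z : grD) (l m n : nat) (s : seq (nat * M)).

Fact single_subproof n y : G n y -> (fun i => if i == n then y else 0) \in mrees_pred G.
Proof.
move=> Gy; rewrite unfold_in; apply/asboolP; split=> [i|].
  by case: eqP => [->|_] //; apply: mfil0.
by exists n.+1 => i lt; case: eqP => // e; rewrite e ltnn in lt.
Qed.

Definition single n y (Gy : G n y) : mrees G := MRees (single_subproof Gy).

Lemma grmod_pi0 : grmod_pi (0 : mrees G) = 0.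
Proof. by apply: (addIr (grmod_pi 0)); rewrite -grmod_piD !add0r. Qed.

Lemma grmod_pi_eq0 (u : mrees G) : grmod_pi u = 0 <-> forall n, fprev G n (u n).
Proof.
rewrite -grmod_pi0 grmod_piE subr0 unfold_in.
by split=> [/asboolP|H]; last exact/asboolP.
Qed.

Lemma gen_span_scale s n m x a : (m, x) \in s -> (m <= n)%N -> B (n - m)%N a ->
  gen_span G s n (a *: x).
Proof.
move=> + mn Ba; elim: s => // -[m' x'] s IHs; rewrite inE => /orP[/eqP[<- <-]|/IHs].
  exists a; rewrite mn; split=> //; rewrite subrr.
  by case: (gen_span_subspace G s n).
exact: gen_span_cons.
Qed.

(** The components of finitely many lifts of generators of gr M. *)
Lemma good_generates : good_filtration G -> exists s, filtered_seq G s /\ generates G s.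
Proof.
case=> N [v vgen].
have /choice[bd bdP] : forall i, exists bd, forall n, (bd <= n)%N -> (repr (v i) : mrees G) n = 0.
  by move=> i; case: (repr (v i)) => u /= /asboolP[].
pose b := \max_i bd i.
pose s : seq (nat * M) := [seq (n, (repr (v i) : mrees G) n) | i <- enum 'I_N, n <- iota 0 b].
exists s; split=> [mx /allpairsP[[i n] [_ _ ->]]|n y Gy]; first exact: mreesP.
have [a ea] := vgen (grmod_pi (single Gy)).
have : grmod_pi (single Gy - \sum_i ract (repr (a i)) (repr (v i))) = 0.
  rewrite grmod_piD ea.
  have -> : \sum_i a i *: v i = grmod_pi (\sum_i ract (repr (a i)) (repr (v i))).
    by rewrite (big_morph _ (@grmod_piD _ _ _ _ G) grmod_pi0).
  by rewrite -grmod_piD subrr grmod_pi0.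
have sumE (U : 'I_N -> mrees G) j : (\sum_i U i : mrees G) j = \sum_i U i j.
  exact: (big_morph (fun u : mrees G => u j)).
move=> /grmod_pi_eq0/(_ n).
rewrite -[X in fprev G n X]/(single Gy n - (\sum_i ract (repr (a i)) (repr (v i)) : mrees G) n).
rewrite sumE /= eqxx => /(prev_gen_span s) Ly.
rewrite -[y](subrK (\sum_i ract_fun (repr (a i)) (repr (v i)) n)).
apply: (subspaceD (gen_span_subspace G s n)) => //.
apply: (subspace_sum _ (gen_span_subspace G s n)) => i _.
apply: (subspace_sum _ (gen_span_subspace G s n)) => j _.
(* the lifts have no component of degree b or more *)
have [lt|ge] := ltnP (n - j) b.
  apply: (@gen_span_scale s n (n - j)); rewrite ?leq_subr ?subKn ?leq_ord //; last exact: reesP.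
  by apply/allpairsP; exists (i, (n - j)%N); rewrite mem_enum mem_iota.
rewrite bdP ?scaler0; first by case: (gen_span_subspace G s n).
by apply: leq_trans ge; apply: leq_bigmax.
Qed.

(** The class of a in degree l of gr D annihilates gr M. *)
Definition annihilates l a := forall n y, G n y -> fprev G (l + n) (a *: y).

Lemma annihilates_prev l a : fprev B l a -> annihilates l a.
Proof. by move=> Ba n y Gy; apply: mprevMr. Qed.

(** On b x one commutes a past b: the commutator lies one step lower in the
    filtration. *)
Lemma annihilates_gens s l a : generates G s -> filtered_seq G s -> B l a ->
  (forall mx, mx \in s -> fprev G (l + mx.1) (a *: mx.2)) -> annihilates l a.
Proof.
move=> sgen sG Ba as0 n y /sgen.
elim: s y {sgen} sG as0 => [|[m x] s IHs] y sG as0; first exact: mprevMl.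
have Gx : G m x := sG (m, x) (mem_head _ _).
case=> b [Bb Ly]; rewrite -[y](subrK (b *: x)) scalerDr; apply: mprevD.
  apply: IHs Ly => mx smx; [apply: sG|apply: as0]; by rewrite inE smx orbT.
case: ifP Bb => [mn Bb|_ ->]; last by rewrite scale0r scaler0; apply: mprev0.
have -> : a *: (b *: x) = b *: (a *: x) + (a * b - b * a) *: x.
  by rewrite !scalerA -scalerDl addrC subrK.
rewrite -(subnK mn); apply: mprevD.
  by rewrite addnCA; apply: mprevMl => //; apply: (as0 (m, x)); apply: mem_head.
by rewrite addnA; apply: mprevMr => //; apply: rfilC.
Qed.

Lemma annihilator_coef z : (forall v : grmod G, z *: v = 0) ->
  forall l, annihilates l (rees_poly (repr z))`_l.
Proof.
move=> z0 l n y Gy; have := z0 (grmod_pi (single Gy)).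
rewrite -{1}[z]gr_repr -[_ *: _]grmod_piZ => /grmod_pi_eq0/(_ (l + n)%N) /=.
rewrite /ract_fun (bigD1 (inord l)) //= inordK ?ltnS ?leq_addr // addKn eqxx.
rewrite big1 ?addr0 // => i il; case: eqP => [e|_]; last by rewrite scaler0.
by case/eqP: il; apply: val_inj; rewrite /= inordK ?ltnS ?leq_addr //; have := ltn_ord i; lia.
Qed.

Lemma annihilates_coef (p : rees B) : (forall l, annihilates l (rees_poly p)`_l) ->
  forall v : grmod G, gr_pi p *: v = 0.
Proof.
move=> p0 v; rewrite -[v]grmod_repr -[_ *: _]grmod_piZ; apply/grmod_pi_eq0 => n.
apply: mprev_sum => i _; rewrite -{1}(subnKC (leq_ord i)).
by apply: p0; apply: mreesP.
Qed.

Definition kappa_rees (c : k) : rees B := Rees (kappa_subproof Gamma c).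

Lemma kappa_combination (I : finType) (X : I -> grD) (c : I -> k) :
  \sum_i kappa Gamma (c i) * X i = gr_pi (\sum_i kappa_rees (c i) * repr (X i)).
Proof.
have pi0 : gr_pi (0 : rees B) = 0.
  by apply: (addIr (gr_pi 0)); rewrite -gr_piD !add0r.
rewrite (big_morph _ (@gr_piD _ B) pi0); apply: eq_bigr => i _.
by rewrite gr_piM gr_repr.
Qed.

Lemma coef_kappa_combination (I : finType) (p : I -> rees B) (c : I -> k) l :
  (rees_poly (\sum_i kappa_rees (c i) * p i))`_l = \sum_i c i *: (rees_poly (p i))`_l.
Proof.
rewrite (big_morph (fun p : rees B => (rees_poly p)`_l) (id1 := 0) (op1 := +%R)) /=.
- by apply: eq_bigr => i _; rewrite coefCM mulr_algl.
- by move=> p' q'; rewrite coefD.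
- by rewrite coef0.
Qed.

Definition solves (I : finType) (eqs : seq {ffun I -> k}) (c : I -> k) :=
  forall f : {ffun I -> k}, f \in eqs -> \sum_i c i * f i = 0.

(** Membership in W is expressed by the vanishing of r linear forms in the
    coefficients, the coordinates in U / W. *)
Lemma reldim_equations (V : lmodType k) (U W : set V) r (I : finType) (u : I -> V) :
  subspace W -> reldim U W r -> (forall i, U (u i)) ->
  exists2 eqs : seq {ffun I -> k}, size eqs = r &
    forall c, solves eqs c -> W (\sum_i c i *: u i).
Proof.
move=> sW [J [v [<- _ span _]]] Uu.
have /choice[C CP] : forall i, exists c : J -> k, W (u i - \sum_j c j *: v j).
  by move=> i; apply: span.
exists [seq [ffun i => C i j] | j <- enum J]; first by rewrite size_map cardE.
move=> c cS.
have -> : \sum_i c i *: u i = \sum_i c i *: (u i - \sum_j C i j *: v j).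
  apply/eqP; rewrite -subr_eq0 -sumrB; apply/eqP.
  under eq_bigr do rewrite -scalerBr opprB addrC subrK scaler_sumr.
  rewrite exchange_big big1 // => j _ /=.
  under eq_bigr do rewrite scalerA; rewrite -scaler_suml.
  rewrite (_ : \sum_i _ = 0) ?scale0r //.
  rewrite -[RHS](cS [ffun i => C i j]); last by apply: map_f; rewrite mem_enum.
  by apply: eq_bigr => i _; rewrite ffunE.
by apply: subspace_sum => // i _; apply: subspaceZ.
Qed.

Lemma too_few_equations (I : finType) (eqs : seq {ffun I -> k}) :
  (size eqs < #|I|)%N -> exists2 c : I -> k, solves eqs c & exists i, c i != 0.
Proof.
move=> lt; pose A := \matrix_(i < #|I|, j < size eqs) (nth [ffun=> 0] eqs j) (enum_val i).
have /rowV0Pn[r rA r0] : kermx A != 0.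
  rewrite -mxrank_eq0 mxrank_ker subn_eq0 -ltnNge.
  exact: leq_ltn_trans (rank_leq_col A) lt.
exists (fun i => r 0 (enum_rank i)) => [f feqs|].
  have jlt : (index f eqs < size eqs)%N by rewrite index_mem.
  have := sub_kermxP rA => /matrixP/(_ 0 (Ordinal jlt)); rewrite !mxE => rA0; rewrite -[RHS]rA0.
  rewrite (reindex _ (onW_bij _ (@enum_val_bij I))) /=.
  by apply: eq_bigr => i _; rewrite enum_valK !mxE nth_index.
have /rV0Pn[j rj] := r0; exists (enum_val j).
by rewrite enum_valK.
Qed.

End Annihilators.

(** * The upper bound for the Krull dimension *)

Section Growth.
Variables (k : numFieldType) (Gamma : numsemigroup).
Local Notation D := (diff_curve k Gamma).
Local Notation B := (bernstein_filtration k Gamma).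
Local Notation grD := (gr B).
Variables (M : lmodType D) (G : mod_filtration B M).
Implicit Types (a b : D) (x y : M) (z : grD) (l m n : nat) (s : seq (nat * M)).

Definition total_dim s n := (\sum_(l < n.+1) gr_dim G s l)%N.

Lemma total_dim_shift s T m :
  (\sum_(l < T.+1) gr_dim G s (l + m) <= total_dim s (T + m))%N.
Proof.
rewrite /total_dim -(big_mkord xpredT (fun l => gr_dim G s (l + m)%N)).
rewrite -(big_mkord xpredT (gr_dim G s)) -addSn.
rewrite (@big_cat_nat _ _ _ m 0 (T.+1 + m)) ?leq_addl //=.
rewrite (_ : \sum_(m <= l < T.+1 + m) _ = \sum_(0 <= l < T.+1) gr_dim G s (l + m))%N.
  exact: leq_addl.
by rewrite -[in LHS](add0n m) big_addn add0n addnK.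
Qed.

(** A combination of the X_i annihilates gr M as soon as its components of
    degree l <= T send each generator x of degree m to zero in
    M_(l+m) / M_(l+m-1); components of degree above T vanish. *)
Lemma module_equations n1 s T (I : finType) (X : I -> grD) :
  cofinite_part (@symbols k Gamma) n1 -> filtered_seq G s -> generates G s ->
  (forall i, (size (phi (X i)) <= T.+1)%N) ->
  exists2 eqs : seq {ffun I -> k}, (size eqs <= \sum_(mx <- s) total_dim s (T + mx.1))%N &
    forall c, solves eqs c ->
      forall v : grmod G, (\sum_i kappa Gamma (c i) * X i) *: v = 0.
Proof.
move=> Agr sG sgen sX.
have /choice[E EP] : forall mxl : (nat * M) * nat, exists eqs : seq {ffun I -> k},
    mxl.1 \in s -> size eqs = gr_dim G s (mxl.2 + mxl.1.1) /\
      forall c, solves eqs c -> fprev G (mxl.2 + mxl.1.1)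
        ((\sum_i c i *: (rees_poly (repr (X i)))`_mxl.2) *: mxl.1.2).
  case=> -[m x] l /=; case: (boolP ((m, x) \in s)) => [smx|]; last by exists [::].
  have Gx : G m x := sG _ smx.
  have [|eqs eqsE eqsP] := @reldim_equations k (kspace M) _ _ _ I
    (fun i => (rees_poly (repr (X i)))`_l *: x) (prev_subspace G (l + m))
    (fil_prev_reldim (l + m) Agr sG sgen).
    by move=> i; apply: mfilM => //; apply: reesP.
  exists eqs => _; split=> // c /eqsP.
  by congr (fprev G _ _); rewrite scaler_suml; apply: eq_bigr => i _; rewrite kscaleE scalerA mulr_algl.
exists (flatten [seq flatten [seq E (mx, l) | l <- iota 0 T.+1] | mx <- s]).
  rewrite size_flatten /shape -map_comp sumnE big_map big_seq [leqRHS]big_seq.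
  apply: leq_sum => mx smx; rewrite /comp size_flatten /shape -map_comp sumnE big_map.
  apply: leq_trans (total_dim_shift s T mx.1).
  rewrite -(big_mkord xpredT (fun l => gr_dim G s (l + mx.1)%N)) /index_iota subn0.
  apply: eq_leq; apply: eq_bigr => l _.
  by have [El _] := EP (mx, l) smx; rewrite /comp El.
move=> c cS; rewrite kappa_combination; apply: annihilates_coef => l.
rewrite coef_kappa_combination.
have Bl : B l (\sum_i c i *: (rees_poly (repr (X i)))`_l).
  by apply: rfil_sum => i _; apply/bernsteinZ/reesP.
have [lT|Tl] := leqP l T.
  apply: (annihilates_gens sgen sG Bl) => mx smx.
  have [_] := EP (mx, l) smx; apply => f fE; apply: cS.
  apply/flatten_mapP; exists mx => //; apply/flatten_mapP; exists l => //.
  by rewrite mem_iota.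
apply/annihilates_prev/sigma_ker => //.
rewrite sigma_sum => [|i _]; last by apply/bernsteinZ/reesP.
rewrite big1 // => i _; rewrite -[c i *: _]addr0 sigmaP ?sigma0 ?addr0; first last.
- exact: rfil0.
- exact: reesP.
- rewrite -coef_phi nth_default ?scaler0 //.
  exact: leq_trans (sX i) Tl.
Qed.

(** T^n monomials that are independent modulo the annihilator cannot outnumber
    the equations of [module_equations], which are at most C' T^d in number;
    T = C' + 1 gives the contradiction. *)
Lemma krull_dim_le n1 s d C n (p : 'I_n.+1 -> prime_idealr grD) :
  cofinite_part (@symbols k Gamma) n1 -> filtered_seq G s -> generates G s ->
  (forall n, (total_dim s n <= C * n.+1 ^ d)%N) ->
  prime_chain (grmod G) p -> (n <= d)%N.
Proof.
move=> Agr sG sgen bound [ann chain].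
have [K chainK] := chain_independent chain.
pose b := \max_(mx <- s) mx.1; pose C' := (size s * (C * (K + b).+1 ^ d))%N.
rewrite leqNgt; apply/negP => dn.
have [I [X [cI sX Xp]]] := chainK C'.+1.
have [eqs eqsz eqsP] := module_equations Agr sG sgen sX.
have : (size eqs < #|I|)%N.
  apply: (leq_ltn_trans eqsz); rewrite cI.
  apply: (@leq_ltn_trans (C' * C'.+1 ^ d)%N); last first.
    rewrite (@leq_trans (C'.+1 ^ d.+1)) ?leq_pexp2l //.
    by rewrite expnS ltn_mul2r ltnSn expn_gt0.
  have -> : (C' * C'.+1 ^ d = \sum_(mx <- s) C * (K + b).+1 ^ d * C'.+1 ^ d)%N.
    rewrite big_const_seq count_predT iter_addn_0.
    by move: (C'.+1 ^ d)%N => X'; rewrite /C' [RHS]mulnC [RHS]mulnA.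
  rewrite big_seq [leqRHS]big_seq; apply: leq_sum => mx smx.
  apply: (leq_trans (bound _)); rewrite -mulnA leq_mul2l -expnMn; apply/orP; right.
  have le : ((K * C'.+1 + mx.1).+1 <= (K + b).+1 * C'.+1)%N.
    have : (mx.1 <= b)%N by apply: (leq_bigmax_seq mx (F := fst)).
    by move: (mx.1) C'.+1 (ltn0Sn C') => m c c0 mb; nia.
  by have [d0|d0] := posnP d; [rewrite [in leqLHS]d0 [in leqRHS]d0|rewrite leq_exp2r].
case/too_few_equations => c /eqsP c0 [i0]; rewrite (Xp c) ?eqxx //.
exact: ann.
Qed.

End Growth.

(** * Eventual linearity of the dimensions of gr M *)

Lemma poly_growth (N : nat -> nat) (P : {poly rat}) d n0 : (size P <= d.+1)%N ->
  (forall n, (n0 <= n)%N -> (N n)%:R = P.[n%:R]) ->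
  exists C, forall n, (N n <= C * n.+1 ^ d)%N.
Proof.
move=> sP NP; pose c := \sum_(i < d.+1) `|P`_i|.
have c0 : 0 <= c by apply: sumr_ge0.
exists (Num.bound c + \sum_(l < n0) N l)%N => n; rewrite mulnDl.
have [ge|lt] := leqP n0 n; last first.
  apply: (@leq_trans (\sum_(l < n0) N l)).
    by rewrite (bigD1 (Ordinal lt)) //= leq_addr.
  by apply: leq_trans (leq_addl _ _); rewrite leq_pmulr // expn_gt0.
apply: leq_trans (leq_addr _ _); rewrite -(ler_nat rat) NP // natrM natrX.
apply: (@le_trans _ _ (c * n.+1%:R ^+ d)); last first.
  by rewrite ler_wpM2r ?exprn_ge0 ?ler0n // ltW // archi_boundP.
rewrite (horner_coef_wide _ sP) mulr_suml; apply: ler_sum => i _.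
apply: (le_trans (ler_norm _)); rewrite normrM ler_wpM2l // normrX.
rewrite ger0_norm ?ler0n //; apply: (@le_trans _ _ (n.+1%:R ^+ i)).
  by rewrite lerXn2r ?nnegrE ?ler0n ?ler_nat.
by rewrite ler_weXn2l ?ler1n // -ltnS.
Qed.

Section Hilbert.
Variables (k : numFieldType) (Gamma : numsemigroup).
Local Notation D := (diff_curve k Gamma).
Local Notation B := (bernstein_filtration k Gamma).
Local Notation grD := (gr B).
Local Notation A := (@symbols k Gamma).
Variables (M : lmodType D) (G : mod_filtration B M).
Implicit Types (a b : D) (x y : M) (z : grD) (l m n : nat) (s : seq (nat * M)).

Definition annihilator_bound (U : nat -> set {poly k}) :=
  graded_ideal A U /\ forall l a, B l a -> annihilates G l a -> U l (sigma l a).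

Lemma cyclic_annihilator_bound s m x : G m x -> annihilator_bound (cyclic_ideal G s m x).
Proof.
move=> Gx; split; first exact: cyclic_idealP.
by move=> l a Ba aM; exists a => //; split=> //; apply/prev_gen_span/aM.
Qed.

(** Here u counts the generators with cyclic ideal 0 and v collects the
    shifts and the eventual dimensions of the other factors.  The two further
    conclusions produce the ideal from which the chains of primes are
    built. *)
Lemma gr_dim_eventually n1 s : cofinite_part A n1 -> filtered_seq G s ->
  exists (u : nat) (v : int) n0, [/\
    forall n, (n0 <= n)%N -> (gr_dim G s n)%:Z = (u * n)%N%:Z + v,
    (0 < u)%N -> exists2 U, annihilator_bound U & forall n p, U n p -> p = 0
  & u = 0%N -> v <> 0 -> exists2 U, annihilator_bound U &
      forall n0, exists2 n, (n0 <= n)%N & quotient_dim A U n <> 0%N].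
Proof.
move=> Agr; elim: s => [|[m x] s IHs] sG.
  by exists 0%N, 0, 0%N; split.
have [|u [v [n0 [dimE free tors]]]] := IHs.
  by move=> mx smx; apply: sG; rewrite inE smx orbT.
have wit := cyclic_annihilator_bound s (sG (m, x) (mem_head _ _)).
have [U0|[v' [n' qdimE]]] := quotient_dim_eventually Agr (cyclic_idealP G s m x).
  exists u.+1, (v + 1 - m%:Z), (n0 + n1 + m)%N; split=> // [n le|_]; last by exists (cyclic_ideal G s m x).
  have mn : (m <= n)%N by lia.
  rewrite /= /cyclic_dim mn (quotient_dim_zero Agr (U0 _)); last by lia.
  by have := dimE n; lia.
exists u, (v + v'%:Z), (n0 + n' + m)%N; split=> // [n le|u0 vv'].
  have mn : (m <= n)%N by lia.
  by rewrite /= /cyclic_dim mn qdimE; have := dimE n; lia.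
have [v'0|v'0] := eqVneq v' 0%N; first by apply: tors => // v0; apply: vv'; rewrite v0 v'0.
exists (cyclic_ideal G s m x) => // n2; exists (n2 + n')%N; first exact: leq_addr.
by rewrite qdimE ?leq_addl //; apply/eqP.
Qed.

(** Summation of u n + v. *)
Lemma total_dim_poly s (u : nat) (v : int) n0 :
  (forall n, (n0 <= n)%N -> (gr_dim G s n)%:Z = (u * n)%N%:Z + v) ->
  exists c : rat, forall n, (n0 <= n)%N -> (total_dim G s n)%:R =
    ((u%:R / 2%:R) *: 'X^2 + (v%:~R + u%:R / 2%:R) *: 'X + c%:P : {poly rat}).[n%:R].
Proof.
move=> dimE; pose Q : {poly rat} := (u%:R / 2%:R) *: 'X^2 + (v%:~R + u%:R / 2%:R) *: 'X.
exists ((total_dim G s n0)%:R - Q.[n0%:R]) => n le; rewrite -/Q.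
rewrite -(subnK le); elim: (n - n0)%N => [|i IHi].
  by rewrite add0n hornerD hornerC addrC subrK.
rewrite addSn /total_dim big_ord_recr /= natrD -/(total_dim G s _) IHi.
have -> : (gr_dim G s (i + n0).+1)%:R = u%:R * (i + n0).+1%:R + v%:~R :> rat.
  rewrite -[LHS]/((gr_dim G s (i + n0).+1)%:Z%:~R) dimE; last by lia.
  by rewrite rmorphD /= -natrM.
have -> : (i + n0).+1%:R = (i + n0)%:R + 1 :> rat by rewrite -addn1 natrD.
move: (total_dim G s n0)%:R (Q.[n0%:R]) ((i + n0)%:R : rat) => N0 Q0 t.
rewrite /Q !(hornerD, hornerZ, hornerXn, hornerX, hornerC).
by field.
Qed.

(** The degree 0 part of gr D is k; a nonzero constant that annihilates gr M
    forces M_n = M_(n-1) for all n, hence M = 0. *)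
Lemma constant_term_annihilator z : (exists x : M, x != 0) ->
  (forall v : grmod G, z *: v = 0) -> constant_term z = 0.
Proof.
move=> [x x0] z0; apply/eqP/negPn/negP => c0; case/eqP: x0.
set c := constant_term z in c0; set a := (rees_poly (repr z))`_0.
have Ba : B 0 a by apply: reesP.
have Bc : B 0 (c%:A) by have := reesP (kappa_rees Gamma c) 0; rewrite /= coefC.
have sa : sigma 0 a = c%:P.
  by rewrite /c constant_termE coef_phi; apply: size1_polyC; apply: size_sigma.
have sc : sigma 0 (c%:A : D) = c%:P.
  have := phi_kappa Gamma c => /(congr1 (fun p : {poly {poly k}} => p`_0)).
  by rewrite coef_phi_pi /= !coefC.
have ac : a = c%:A.
  apply/eqP; rewrite -subr_eq0; apply/eqP.
  by apply: (@sigma_ker k Gamma 0); [apply: rfilB|rewrite sigmaB // sa sc subrr].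
have GG n y : G n y -> fprev G n y.
  move=> Gy; have := annihilator_coef z0 0%N Gy; rewrite -/a ac add0n.
  move=> /(subspaceZ c^-1 (prev_subspace G n)).
  by rewrite kscaleE scalerA mulr_algl scalerA mulVf // !scale1r.
have [n] := mfilT G x; elim: n => [|n IHn] /GG //.
Qed.

End Hilbert.

(** * Chains of primes above the annihilator *)

Section Chains.
Variables (k : numClosedFieldType) (Gamma : numsemigroup).
Local Notation D := (diff_curve k Gamma).
Local Notation B := (bernstein_filtration k Gamma).
Local Notation grD := (gr B).
Local Notation A := (@symbols k Gamma).
Variables (M : lmodType D) (G : mod_filtration B M).
Implicit Types (z : grD) (l m n : nat).

Local Notation irrelevant := (kernel (@constant_term k Gamma)).
Local Notation at_point a := (kernel (@value_at k Gamma a)).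
Local Notation at_infinity := (kernel (@value_at_infinity k Gamma)).
Local Notation zero_ideal := (@kernel grD {poly {poly k}} (@phi k Gamma)).

Lemma at_point_irrelevant a : {subset at_point a <= irrelevant} /\
  exists2 z, z \in irrelevant & z \notin at_point a.
Proof.
split=> [z|].
  rewrite !kernelE /= => /eqP z0; have := coef_value_at a z 0; rewrite z0 coef0.
  by rewrite constant_termE (size1_polyC (size_coef_phi z 0)) hornerC coefC => <-.
have [n1 mon] := monomial_exists k Gamma.
have [z zE] := mon n1.+1 0%N (leqnSn _) (leq0n _); exists z; rewrite kernelE /=.
  by rewrite constant_termE zE coefCM coefXn mulr0 coef0.
apply/eqP => /polyP/(_ n1.+1); rewrite coef_value_at zE coefCM coefXn eqxx mulr1.
by rewrite expr0 hornerC coef0 => /eqP; rewrite oner_eq0.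
Qed.

Lemma at_infinity_irrelevant : {subset at_infinity <= irrelevant} /\
  exists2 z, z \in irrelevant & z \notin at_infinity.
Proof.
split=> [z|].
  rewrite !kernelE /= => /eqP z0; have := coef_value_at_infinity z 0; rewrite z0 coef0.
  by rewrite constant_termE => <-.
have [n1 mon] := monomial_exists k Gamma.
have [z zE] := mon n1.+1 n1.+1 (leqnSn _) (leqnn _); exists z; rewrite kernelE /=.
  by rewrite constant_termE zE coefCM coefXn mulr0 coef0.
apply/eqP => /polyP/(_ n1.+1); rewrite coef_value_at_infinity zE coefCM coefXn eqxx mulr1.
by rewrite coefXn eqxx coef0 => /eqP; rewrite oner_eq0.
Qed.

Lemma zero_at_point : {subset zero_ideal <= at_point 0} /\
  exists2 z, z \in at_point 0 & z \notin zero_ideal.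
Proof.
split=> [z|].
  rewrite !kernelE /= => /eqP z0; apply/eqP/polyP => i.
  by rewrite coef_value_at z0 !coef0 horner0.
have [n1 mon] := monomial_exists k Gamma.
have [z zE] := mon n1.+1 1%N (leqnSn _) (ltn0Sn _); exists z; rewrite kernelE /=.
  apply/eqP/polyP => i; rewrite coef_value_at zE coefCM coefXn coef0.
  by case: eqP => _; rewrite ?mulr1 ?mulr0 ?hornerX ?horner0.
by rewrite zE mulf_neq0 ?polyC_eq0 ?polyX_eq0 ?expf_neq0 ?polyX_eq0.
Qed.

Lemma prime_chain1 (p0 : prime_idealr grD) :
  (forall z, (forall v : grmod G, z *: v = 0) -> z \in p0) ->
  exists p : 'I_1 -> prime_idealr grD, prime_chain (grmod G) p.
Proof. by move=> ann; exists (fun _ => p0); split=> [i|i j]; rewrite ?ord1. Qed.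

Lemma prime_chain2 (p0 p1 : prime_idealr grD) :
  (forall z, (forall v : grmod G, z *: v = 0) -> z \in p0) ->
  {subset p0 <= p1} /\ (exists2 z, z \in p1 & z \notin p0) ->
  exists p : 'I_2 -> prime_idealr grD, prime_chain (grmod G) p.
Proof.
move=> ann p01; exists (fun i => if i == 0 then p0 else p1); split=> [i z /ann zp|i j].
  by case: ifP => // _; apply: p01.1.
by case: i => [[|[|]]] //; case: j => [[|[|]]].
Qed.

Lemma prime_chain3 (p0 p1 p2 : prime_idealr grD) :
  (forall z, (forall v : grmod G, z *: v = 0) -> z \in p0) ->
  {subset p0 <= p1} /\ (exists2 z, z \in p1 & z \notin p0) ->
  {subset p1 <= p2} /\ (exists2 z, z \in p2 & z \notin p1) ->
  exists p : 'I_3 -> prime_idealr grD, prime_chain (grmod G) p.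
Proof.
move=> ann p01 p12.
have p02 : {subset p0 <= p2} /\ exists2 z, z \in p2 & z \notin p0.
  split=> [z /p01.1/p12.1//|]; case: p12 => _ [z z2 z1]; exists z => //.
  by apply: contra z1; apply: p01.1.
exists (fun i : 'I_3 => if i == 0 :> nat then p0 else if i == 1%N :> nat then p1 else p2).
split=> [i z /ann zp|i j].
  by case: ifP => // _; case: ifP => _; [apply: p01.1|apply: p02.1].
by case: i => [[|[|[|]]]] //; case: j => [[|[|[|]]]].
Qed.

End Chains.

Section Main.
Variables (k : numClosedFieldType) (Gamma : numsemigroup).
Local Notation D := (diff_curve k Gamma).
Local Notation B := (bernstein_filtration k Gamma).
Local Notation grD := (gr B).
Local Notation A := (@symbols k Gamma).
Variables (M : lmodType D) (G : mod_filtration B M).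
Local Notation irrelevant := (kernel (@constant_term k Gamma)).
Local Notation at_point a := (kernel (@value_at k Gamma a)).
Local Notation at_infinity := (kernel (@value_at_infinity k Gamma)).
Local Notation zero_ideal := (@kernel grD {poly {poly k}} (@phi k Gamma)).

Lemma annihilator_symbols (U : nat -> set {poly k}) z : annihilator_bound G U ->
  (forall v : grmod G, z *: v = 0) -> forall l, U l ((phi z)`_l).
Proof.
move=> [_ UA] z0 l; rewrite coef_phi; apply: UA; first exact: reesP.
exact: annihilator_coef.
Qed.

Lemma dim0_chain : (exists x : M, x != 0) ->
  exists p : 'I_1 -> prime_idealr grD, prime_chain (grmod G) p.
Proof.
move=> M0; apply: (prime_chain1 (p0 := irrelevant)) => z z0.
by rewrite kernelE; apply/eqP/(constant_term_annihilator M0 z0).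
Qed.

(** The annihilator vanishes where U does, at a point of the projective
    line. *)
Lemma dim1_chain n1 (U : nat -> set {poly k}) : cofinite_part A n1 ->
  annihilator_bound G U -> (forall n0, exists2 n, (n0 <= n)%N & quotient_dim A U n <> 0%N) ->
  exists p : 'I_2 -> prime_idealr grD, prime_chain (grmod G) p.
Proof.
move=> Agr UA dimU.
have [[a Ua]|Uinf] := gideal_common_zero Agr UA.1 dimU.
  apply: (prime_chain2 (p0 := at_point a) (p1 := irrelevant)); last exact: at_point_irrelevant.
  move=> z z0; rewrite kernelE; apply/eqP/polyP => l.
  rewrite coef_value_at coef0; apply/rootP/(Ua l); exact: (annihilator_symbols UA).
apply: (prime_chain2 (p0 := at_infinity) (p1 := irrelevant)); last exact: at_infinity_irrelevant.
move=> z z0; rewrite kernelE; apply/eqP/polyP => l.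
rewrite coef_value_at_infinity coef0 nth_default //.
by apply: (Uinf l); apply: (annihilator_symbols UA).
Qed.

(** The annihilator is contained in U = 0. *)
Lemma dim2_chain (U : nat -> set {poly k}) :
  annihilator_bound G U -> (forall n p, U n p -> p = 0) ->
  exists p : 'I_3 -> prime_idealr grD, prime_chain (grmod G) p.
Proof.
move=> UA U0.
apply: (prime_chain3 (p0 := zero_ideal) (p1 := at_point 0) (p2 := irrelevant)).
- move=> z z0; rewrite kernelE; apply/eqP/polyP => l.
  by rewrite coef0; apply: (U0 l); apply: annihilator_symbols.
- exact: zero_at_point.
- exact: at_point_irrelevant.
Qed.

(** * The Hilbert polynomial and the dimension *)

Lemma hilbert_polynomial : (exists x : M, x != 0) -> good_filtration G ->
  exists (P : {poly rat}) (d e n0 : nat),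
    [/\ forall n, (n0 <= n)%N ->
          exists2 N : nat, dim_eq (G n) N & N%:R = P.[n%:R],
        krull_dim (grmod G) d,
        (0 < e)%N
      & (size (P - (e%:R / (d`!)%:R) *: 'X^d)%R <= d)%N].
Proof.
move=> M0 /good_generates[s [sG sgen]].
have [n1 Agr] := symbols_cofinite k Gamma.
have dimG n : dim_eq (G n) (total_dim G s n) := dim_eq_reldim (fil_reldim n Agr sG sgen).
have [u [v [n0 [dimE free tors]]]] := gr_dim_eventually Agr sG.
have [c cP] := total_dim_poly dimE; move: cP; set P := (_ + c%:P) => cP.
suff [d [e [sP e0 [p pP]]]] : exists d e, [/\ (size (P - (e%:R / (d`!)%:R) *: 'X^d)%R <= d)%N,
    (0 < e)%N & exists p : 'I_d.+1 -> prime_idealr grD, prime_chain (grmod G) p].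
  exists P, d, e, n0; split=> // [n le|]; first by exists (total_dim G s n); last exact: cP.
  split; first by exists p.
  have [C bound] : exists C, forall n, (total_dim G s n <= C * n.+1 ^ d)%N.
    apply: (poly_growth (P := P) (n0 := n0)) => //.
    rewrite -[P](subrK ((e%:R / (d`!)%:R) *: 'X^d)).
    apply: (leq_trans (size_polyD _ _)); rewrite geq_max (leq_trans sP) //=.
    by apply: (leq_trans (size_scale_leq _ _)); rewrite size_polyXn.
  by move=> n q; apply: (krull_dim_le Agr sG sgen bound).
(* d = 2 and e = u *)
have [u0|u0] := posnP u; last first.
  have [U UA U0] := free u0; exists 2%N, u; split=> //; last exact: dim2_chain UA U0.
  have -> : P - (u%:R / (2`!)%:R) *: 'X^2 = (v%:~R + u%:R / 2%:R) *: 'X + c%:P.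
    by rewrite /P addrAC [X in X + _ = _]addrAC subrr add0r.
  by rewrite -mul_polyC size_MXaddC; case: ifP => // _; rewrite ltnS size_polyC leq_b1.
have PE : P = v%:~R *: 'X + c%:P by rewrite /P u0 mul0r scale0r add0r addr0.
have v0 : 0 <= v by have := dimE n0 (leqnn _); rewrite u0 mul0n add0r => <-.
(* d = 1 and e = v *)
have [v_eq0|v_neq0] := eqVneq v 0; last first.
  have [U UA dimU] := tors u0 (elimN eqP v_neq0); exists 1%N, `|v|%N; split; last exact: dim1_chain Agr UA dimU.
  - rewrite divr1 PE expr1 -[v in v%:~R]gez0_abs //.
    by rewrite addrAC subrr add0r size_polyC leq_b1.
  - by rewrite absz_gt0.
(* d = 0 and e = dim M, which is positive because M <> 0 *)
exists 0%N, (total_dim G s n0); split; last exact: dim0_chain.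
- by rewrite (cP n0) // PE v_eq0 scale0r add0r hornerC divr1 expr0 -mul_polyC mulr1 subrr size_poly0.
- rewrite lt0n; apply/eqP => N0; have [x x0] := M0; case/eqP: x0.
  have [n Gx] := mfilT G x.
  have Gx' : G (n0 + n)%N x.
    by elim: n0 {dimE cP N0} => // j IHj; apply: mfilS.
  have [w [_ span _]] := dimG (n0 + n)%N.
  have Nn : total_dim G s (n0 + n) = 0%N.
    apply/eqP; rewrite -(eqr_nat rat) (cP (n0 + n)%N) ?leq_addr //.
    by rewrite -N0 (cP n0) // PE v_eq0 scale0r add0r !hornerC.
  have [a ->] := span x Gx'.
  by rewrite big1 // => i; have := ltn_ord i; rewrite {2}Nn.
Qed.

End Main.

Theorem proposition3 (R : realType) (Gamma : numsemigroup)
    (M : lmodType (diff_curve R[i] Gamma))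
    (G : mod_filtration (bernstein_filtration R[i] Gamma) M) :
  (exists x : M, x != 0) -> fin_gen M -> good_filtration G ->
  exists (m : nat) (P : 'I_m -> {poly rat}) (d e : nat),
    [/\ (0 < m)%N,
        exists n0 : nat, forall n : nat, (n0 <= n)%N -> forall r : 'I_m,
          exists2 N : nat, dim_eq (G (n * m + r)%N) N & N%:R = (P r).[n%:R],
        krull_dim (grmod G) d,
        (0 < e)%N
      & forall r : 'I_m,
          (size (P r - (e%:R / (d`!)%:R) *: 'X^d)%R <= d)%N].
Proof.
move=> M0 _ Ggood; have [P [d [e [n0 [PE dE e0 sP]]]]] := @hilbert_polynomial R[i] _ _ G M0 Ggood.
exists 1%N, (fun _ => P), d, e; split=> //; exists n0 => n le r.
by rewrite ord1 muln1 addn0; apply: PE.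
Qed.
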